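(* Let $(\Sigma,\theta)$ be a topologically transitive (one-sided) subshift of finite type over a finite alphabet $\mathcal{A}$, let $\varphi:\Sigma\to\mathbb{R}$ be a Hölder continuous and normalized potential, let $G$ be a word-hyperbolic, non-elementary group, and let $\gamma:\mathcal{A}\to G$ be a map such that the skew product $S:\Sigma\times G\to\Sigma\times G$, $S(\xi,g)=(\theta\xi,g\gamma(\xi))$, is topologically transitive. Then there exists $a>0$ such that for $\nu$-almost every $\xi\in\Sigma$, $$\lim_{n\to\infty}\frac{d_G(\gamma_n(\xi),\mathrm{id})}{n}=a.$$
   Context: $\gamma$ is regarded as a map $\Sigma\to G$ by $\gamma(x_0x_1\ldots)=\gamma(x_0)$, and $\gamma_n(\xi)=\gamma(\xi)\gamma(\theta\xi)\cdots\gamma(\theta^{n-1}\xi)$. $\varphi$ is normalized if $\sum_{\theta\eta=\xi}e^{\varphi(\eta)}=1$ for all $\xi\in\Sigma$; $\nu$ is the unique $\theta$-invariant ergodic probability measure with $d\nu/d\nu\circ\theta=e^{\varphi}$. $G$ is discrete; $S$ is topologically transitive if for nonempty open $U,V\subset\Sigma\times G$ there is $n\in\mathbb{N}$ with $S^{-n}(U)\cap V\ne\emptyset$ (similarly for $\theta$). $d_G=d_w$ is the word metric with respect to a fixed finite symmetric generating set. Non-elementary means neither finite nor virtually cyclic. *)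

(* Defs.v *)
(* Written on top of Mathematical Components and MathComp-Analysis. *)
From HB Require Import structures.
From mathcomp Require Import all_boot all_order all_algebra.
From mathcomp Require Import all_classical all_reals all_analysis.

Set Implicit Arguments.
Unset Strict Implicit.
Unset Printing Implicit Defensive.

Import Order.TTheory GRing.Theory Num.Theory.
Import numFieldNormedType.Exports.

Local Open Scope classical_set_scope.
Local Open Scope ring_scope.

Definition full_shift (A : finType) :=
  prod_topology (fun _ : nat => discrete_topology A).

HB.instance Definition _ (A : finType) := Topological.on (full_shift A).

Definition avoiding (A : finType) (F : seq (seq A)) : set (full_shift A) :=
  [set x | forall w, w \in F -> forall i, mkseq (fun j => x (i + j)%N) (size w) <> w].

Record sft (A : finType) := Sft {
  forbidden : seq (seq A);
  sft_nonempty : avoiding forbidden !=set0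
}.

Definition sft_space (A : finType) (X : sft A) : Type :=
  set_type (avoiding (forbidden X)).

HB.instance Definition _ (A : finType) (X : sft A) :=
  Topological.copy (sft_space X) (set_type (avoiding (forbidden X))).

(* The library's measurable types are pointed; the base point is arbitrary and
   carries no information. *)
Definition sft_point (A : finType) (X : sft A) : sft_space X :=
  SigSub (mem_set (projT2 (cid (sft_nonempty X)))).

HB.instance Definition _ (A : finType) (X : sft A) :=
  isPointed.Build (sft_space X) (sft_point X).

Section SFT.
Variables (A : finType) (X : sft A).

Definition letter (xi : sft_space X) (n : nat) : A := (\val xi : full_shift A) n.

Lemma sft_shift_subproof (xi : sft_space X) :
  ((fun n => letter xi n.+1) : full_shift A) \in avoiding (forbidden X).
Proof.
apply/mem_set => w wF i; have := set_mem (valP xi) w wF i.+1.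
by rewrite (eq_mkseq (_ : _ =1 fun j => letter xi (i + j).+1)).
Qed.

Definition sft_shift (xi : sft_space X) : sft_space X :=
  SigSub (sft_shift_subproof xi).

(* The infimum of the 2 ^- n such that the first n letters coincide, that is,
   2 ^- (first disagreement), and 0 on the diagonal. *)
Definition sft_dist (R : realType) (xi eta : sft_space X) : R :=
  inf [set (2^-1 : R) ^+ n |
       n in [set n | forall i, (i < n)%N -> letter xi i = letter eta i]].

Definition hoelder_continuous (R : realType) (phi : sft_space X -> R) :=
  exists alpha C : R, [/\ 0 < alpha, alpha <= 1 &
    forall xi eta,
      `|phi xi - phi eta| <= C * (sft_dist R xi eta) `^ alpha].

(* The fibres of the shift are finite, so that this is an honest sum. *)
Definition normalized (R : realType) (phi : sft_space X -> R) :=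
  forall xi, \sum_(eta \in sft_shift @^-1` [set xi]) expR (phi eta) = 1.

Definition borel_sft := g_sigma_algebraType (@open (sft_space X)).

HB.instance Definition _ := Measurable.on borel_sft.

Definition shift_invariant (R : realType) (nu : probability borel_sft R) :=
  forall B : set borel_sft, measurable B -> nu (sft_shift @^-1` B) = nu B.

Definition ergodic (R : realType) (nu : probability borel_sft R) :=
  forall B : set borel_sft, measurable B -> sft_shift @^-1` B = B ->
    nu B = 0%E \/ nu B = 1%E.

(* d nu / d (nu o shift) = exp phi. As usual for a countable-to-one map, the
   measure nu o shift is the one given by B |-> nu (shift B) on the Borel sets
   B on which the shift is injective; since the shift is injective on
   cylinders of length one, this determines it. *)
Definition has_jacobian (R : realType) (nu : probability borel_sft R)
    (phi : sft_space X -> R) :=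
  exists nu_shift : {measure set borel_sft -> \bar R},
    (forall B : set borel_sft, measurable B -> {in B &, injective sft_shift} ->
       nu_shift B = nu (sft_shift @` B)) /\
    (forall B : set borel_sft, measurable B ->
       nu B = (\int[nu_shift]_(xi in B) (expR (phi xi))%:E)%E).

End SFT.

Definition topologically_transitive (T : topologicalType) (f : T -> T) :=
  forall U V : set T, open U -> open V -> U !=set0 -> V !=set0 ->
    exists n : nat, (iter n f @^-1` U) `&` V !=set0.

Section Groups.
Variables (G : groupType) (R : realType).
Local Open Scope group_scope.

Definition word_in (E : seq G) (w : seq G) := all (fun s => s \in E) w.

Definition symmetric_generating (E : seq G) :=
  (forall s, s \in E -> s^-1 \in E) /\
  (forall g : G, exists2 w : seq G, word_in E w & \prod_(s <- w) s = g).

Definition word_length (E : seq G) (g : G) : R :=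
  inf [set (size w)%:R%R |
       w in [set w : seq G | word_in E w /\ \prod_(s <- w) s = g]].

Definition word_dist (E : seq G) (g h : G) : R := word_length E (g^-1 * h).

Definition cyclic_subgroup (g : G) : set G :=
  [set x | exists n : nat, x = g ^+ n \/ x = g ^- n].

Definition finite_index (H : set G) :=
  finite_set (range (fun x : G => [set x * h | h in H])).

Definition virtually_cyclic := exists g : G, finite_index (cyclic_subgroup g).

Definition non_elementary := ~ finite_set [set: G] /\ ~ virtually_cyclic.

End Groups.

Definition gromov_product (R : realType) (T : Type) (d : T -> T -> R)
  (w x y : T) : R := (d w x + d w y - d x y) / 2.

Definition gromov_hyperbolic (R : realType) (T : Type) (d : T -> T -> R) :=
  exists delta : R, forall w x y z,
    gromov_product d w x z >=
      Num.min (gromov_product d w x y) (gromov_product d w y z) - delta.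

Definition word_hyperbolic (R : realType) (G : groupType) :=
  exists2 E : seq G, symmetric_generating E & gromov_hyperbolic (word_dist R E).

Section SkewProduct.
Variables (A : finType) (X : sft A) (G : groupType) (gamma : A -> G).

Definition gamma_sft (xi : sft_space X) : G := gamma (letter xi 0).

Definition cocycle (n : nat) (xi : sft_space X) : G :=
  (\prod_(i < n) gamma_sft (iter i (@sft_shift A X) xi))%g.

Definition skew_product (p : sft_space X * discrete_topology G) :
    sft_space X * discrete_topology G :=
  (sft_shift p.1, ((p.2 : G) * gamma_sft p.1)%g).

End SkewProduct.

(* Main.v *)
(* Along the skew product, prepending letters to a point of [Sigma] is a random walk on [G]
   with weights [exp phi]; the Jacobian condition says that [nu] is stationary for it.

   A hyperbolic group which is not virtually cyclic contains tripods with arbitrarily long legs,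
   hence grows exponentially, hence some annulus [S] of the Cayley graph has only small shadows.
   Each [a] in [S] maps the complement of the shadow of [a^-1] into the shadow of [a], so no
   function in [l^2(G)] is almost invariant under all translations by [S]. By topological
   transitivity of the skew product, any two elements of [S] are reached from every point of
   [Sigma] through long common cylinders, on which the iterates of the transfer operator are
   almost constant; uniform convexity then makes a lazy version of this operator contract in
   [l^2(G)]. The walk thus charges balls of radius [r] at time [n] by at most
   [|B_r|^(1/2) rho^n], which excludes zero drift.

   The limit exists by the subadditive ergodic theorem. Its lower half is a greedy covering of
   orbits; the upper half applies the lower half to the additive cocycle [C k - f_k]. *)
Require Import Defs.
From HB Require Import structures.
From mathcomp Require Import all_boot all_order all_algebra.
From mathcomp Require Import all_classical all_reals all_analysis.
From mathcomp Require Import measurable_realfun zify ring lra.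

Set Implicit Arguments.
Unset Strict Implicit.
Unset Printing Implicit Defensive.

Import Order.TTheory GRing.Theory Num.Theory.
Import numFieldNormedType.Exports.

(** * Hyperbolic word metrics *)

(** Three obstacles shape the argument. The operator acts on functions of a point of [Sigma] and a
    group element, while non-amenability concerns functions on [G] alone. The bridge is a [cone] of
    functions with log-Hölder distortion in the [Sigma] direction, which the operator preserves,
    together with the supremum over [Sigma] of the [l^2(G)] norm. The contraction is only applied to
    functions of finite support in [G], so finite sums suffice.

    Hyperbolicity is given for some generating set, which may differ from the [E] of the theorem. It
    is therefore converted into [hyperbolic_nonamenable], whose conclusion mentions no metric; [E]
    matters afterwards only through its length function and the exponential bound on its balls.

    Averages over inverse branches become averages along forward orbits by integration against [nu].
    As the contracting operator mixes all times up to [m], this yields, for each [p], only some time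
    [j <= L p] with mean length above [p / 2]. Subadditivity of the mean lengths closes this gap. *)

Lemma mulgXV (G : groupType) (u : G) m n : (exists k : nat,
  u ^+ m * u ^- n = u ^+ k \/ u ^+ m * u ^- n = u ^- k)%g.
Proof.
have [nm|/ltnW nm] := leqP n m; first by exists (m - n)%N; left; rewrite expgnFr.
by exists (n - m)%N; right; rewrite -{1}(subnK nm) expgnDr invgM mulVKg.
Qed.

(* Distances are natural numbers: [gp] is twice the Gromov product and [D] is twice the
   hyperbolicity constant. *)
Section WordGeometry.
Variables (G : groupType) (ell : G -> nat) (ball : nat -> seq G) (D : nat).
Local Open Scope group_scope.
Local Notation d x y := (ell (x^-1 * y)).
Local Notation gp w x y := (d w x + d w y - d x y)%N.

Hypothesis ell1 : ell 1 = 0%N.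
Hypothesis ellV : forall x, ell x^-1 = ell x.
Hypothesis ellM : forall x y, (ell (x * y) <= ell x + ell y)%N.
Hypothesis ell_prefix : forall g k, (k <= ell g)%N ->
  exists p, ell p = k /\ ell (p^-1 * g) = (ell g - k)%N.
Hypothesis mem_ball : forall n g, (g \in ball n) = (ell g <= n)%N.
Hypothesis ball_uniq : forall n, uniq (ball n).
Hypothesis hyperbolic4 : forall w x y z,
  (d x z + d w y <= maxn (d x y + d w z) (d y z + d w x) + D)%N.

Let d1 x : d 1 x = ell x. Proof. by rewrite invg1 mul1g. Qed.
Let dC x y : d x y = d y x. Proof. by rewrite -ellV invgM invgK. Qed.
Let dM g x y : d (g * x) (g * y) = d x y.
Proof. by rewrite invgM mulgA mulgVK. Qed.
Let dT x y z : (d x z <= d x y + d y z)%N.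
Proof. by rewrite -{1}[z](mulVKg y) [in X in (X <= _)%N]mulgA; exact: ellM. Qed.
Let d1r x : d x 1 = ell x. Proof. by rewrite mulg1 ellV. Qed.
Let dMl g y : d g (g * y) = ell y. Proof. by rewrite mulKg. Qed.

Let dle x y : (d x y <= ell x + ell y)%N.
Proof. by rewrite -(ellV x). Qed.

Let hyp1 x y z : (d x z + ell y <= maxn (d x y + ell z) (d y z + ell x) + D)%N.
Proof. by have := hyperbolic4 1 x y z; rewrite !d1. Qed.

(** The four-point inequality for [1], [g^-1], [g^(n+1)], [g] leaves two alternatives. The one that
    does not give the next step would make [g^(n+1)] shorter than the previous step allows, since
    [ell g > s + 2 D]. *)
Lemma power_step g s : (gp 1 g g^-1 <= s)%N -> (s + D + D < ell g)%N ->
  forall n, (ell g + ell (g ^+ n) <= ell (g ^+ n.+1) + (s + D))%N /\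
    (n <= ell (g ^+ n))%N.
Proof.
move=> gs sl; elim=> [|n [IH1 IH2]].
  by rewrite expg0 expg1 ell1; split; lia.
have e1 : d g (g ^+ n.+1) = ell (g ^+ n) by rewrite expgS dMl.
have e2 : d g^-1 (g ^+ n.+1) = ell (g ^+ n.+2) by rewrite invgK (expgS _ n.+1).
have := hyp1 g^-1 (g ^+ n.+1) g; have := dC (g ^+ n.+1) g; have := dC g g^-1.
rewrite e1 e2 !ellV; move: gs; rewrite !d1 ellV.
move=> gs c1 c2; rewrite c2 -c1.
split; last by lia.
lia.
Qed.

(* On a geodesic [b = a c] one has [(a^-1 | c) = 0]; if [a], [b] and [c] were all close to their
   inverses, hyperbolicity would chain [a^-1, a, b, b^-1, c^-1, c] together. *)
Lemma exists_loxodromic n : (forall m, exists g, (m < ell g)%N) ->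
  exists g, (n <= ell g)%N /\ (gp 1 g g^-1 <= 4 * D)%N.
Proof.
move=> unbdd; pose T := (n + 4 * D + 1)%N.
have [b0 /ltnW/ell_prefix [b [lb _]]] := unbdd (2 * T)%N.
have [|a [la lc]] := @ell_prefix b T; first by lia.
pose c := a^-1 * b; have bE : b = a * c by rewrite mulVKg.
rewrite -/c in lc.
have dac : d a^-1 c = ell b by rewrite invgK -bE.
have dbc : d b^-1 c^-1 = ell a by rewrite bE invgK mulgK.
have [Ha|Ha] := leqP (gp 1 a a^-1) (4 * D); first by exists a; split=> //; lia.
have [Hb|Hb] := leqP (gp 1 b b^-1) (4 * D); first by exists b; split=> //; lia.
have [Hc|Hc] := leqP (gp 1 c c^-1) (4 * D); first by exists c; split=> //; lia.
have ab : d a b = ell c by [].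
have := hyp1 a^-1 a b; have := hyp1 a^-1 b b^-1.
have := hyp1 a^-1 b^-1 c^-1; have := hyp1 a^-1 c^-1 c.
have := dC a a^-1; have := dC b b^-1; have := dC c c^-1.
move: Ha Hb Hc; rewrite !d1 !ellV; move: dac dbc ab lb la lc.
by clear; lia.
Qed.

(** [p] lies on a geodesic from [x] to [y] at distance [(y | z)_x] from [x], where the center of a
    tripod in a tree would be. The [+ 2] pays for rounding this half-integer down. *)
Lemma approx_center x y z : exists p,
  [/\ (gp p x y <= D + 2)%N, (gp p y z <= D + 2)%N, (gp p x z <= D + 2)%N &
   [/\ (gp x y z <= 2 * d p x + 2)%N, (gp y x z <= 2 * d p y + 2)%N &
       (gp z x y <= 2 * d p z + 2)%N]].
Proof.
pose t := (gp x y z)./2.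
have [|p0 [lp0 lp1]] := @ell_prefix (x^-1 * y) t.
  by have := dT x y z; have := dT x z y; have := dC y z; rewrite /t; lia.
pose p := x * p0; have xp : d x p = t by rewrite /p dMl.
have py : d p y = (d x y - t)%N by rewrite /p invgM -mulgA.
have := hyperbolic4 x p y z; have := hyperbolic4 y p x z.
have := (dC x y, dC y z, dC x z, dC x p, dC y p, dC z p).
move=> [[[[[h1 h2] h3] h4] h5] h6].
have := dT x y z; have := dT x z y; have := dT y x z.
have := dT p x y; have := dT p y z; have := dT p x z.
have := dT z p y; have := dT y p z; have := dT x p z.
move: xp py h1 h2 h3 h4 h5 h6; rewrite /t => *.
exists p; split; [lia..|split; lia].
Qed.

(* Translate [z] by the power of [g] closest to it: then [z], [g^M] and [g^-M] span a triangle
   whose center is far from [g^M] and [g^-M], hence close to [z]. *)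
Lemma thin_quasi_cyclic L : (forall m, exists g, (m < ell g)%N) ->
  (forall x y z, [|| gp x y z < L, gp y x z < L | gp z x y < L]%N) ->
  exists g R, forall z, exists h,
    (exists n : nat, h = g ^+ n \/ h = g ^- n) /\ (d h z <= R)%N.
Proof.
move=> unbdd thin; have [g [lg gs]] := exists_loxodromic (4 * D + D + D + D + 1) unbdd.
have [s sE] : exists s, s = (4 * D)%N by exists (4 * D)%N.
rewrite -sE in gs.
have [P1 P2] : (s + D + D < ell g)%N /\ (s + D + D < ell g^-1)%N
  by rewrite ellV sE; split; lia.
have gs' : (gp 1 g^-1 g^-1^-1 <= s)%N.
  by move: gs; have := dC g g^-1; rewrite !d1 !invgK !ellV; lia.
have pos := power_step gs P1; have neg := power_step gs' P2.
(* So large that the sides of the triangle leading to [g^(M+1)] and [g^-(M+1)] cannot be the short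
   ones in [thin]. *)
have [M lM] : exists M, (L + ell g + ell g + D + D + D + s < M)%N by exists (L + ell g + ell
  g + D + D + D + s).+1.
exists g, (L + ell g + ell g + D + D + D + s)%N => z.
pose H h := exists n : nat, h = g ^+ n \/ h = g ^- n.
have Hstep h k : H h -> H (h * g ^+ k) /\ H (h * g ^- k).
  rewrite /H => -[n [|] ->]; split.
  - by exists (n + k)%N; left; rewrite expgnDr.
  - exact: mulgXV.
  - have [j [Hj|Hj]] := mulgXV g^-1 n k; exists j; [right|left].
      by rewrite -!expVgn -Hj !expVgn invgK.
    by rewrite -[g in RHS]invgK expVgn -Hj !expVgn invgK.
  - by exists (k + n)%N; right; rewrite expgnDr invgM.
have exP : exists m, `[< exists h, H h /\ d h z = m >].
  by exists (d 1 z); apply/asboolP; exists 1; split=> //; exists 0%N; left.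
case: (ex_minnP exP) => m /asboolP [h [Hh hm]] mmin.
exists h; split=> //; rewrite hm.
have zmin h' : H h' -> (m <= d h' z)%N by move=> Hh'; apply: mmin; apply/asboolP; exists h'.
pose w := h^-1 * z.
have dw u : d w u = d (h * u) z by rewrite /w -(dM h) mulVKg dC.
have lw : ell w = m by rewrite -hm.
have [/zmin wM /zmin wM'] := Hstep _ M.+1 Hh; rewrite -!dw in wM wM'.
have [/zmin w1 /zmin w1'] := Hstep _ 1%N Hh; rewrite !expg1 -!dw in w1 w1'.
have [a1 a2] := pos M.+1; have [b1 b2] := neg M.+1.
have [a3 _] := pos M; have [b3 _] := neg M.
have xg : d (g ^+ M.+1) g = ell (g ^+ M) by rewrite dC expgS dMl.
have xg' : d (g ^+ M.+1) g^-1 = ell (g ^+ M.+2) by rewrite dC invgK (expgS _ M.+1).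
have yg : d (g ^- M.+1) g^-1 = ell (g ^- M) by rewrite dC -!expVgn expgS dMl.
have lx : ell (g ^- M.+1) = ell (g ^+ M.+1) by rewrite ellV.
have ly : ell (g ^- M) = ell (g ^+ M) by rewrite ellV.
rewrite !expVgn ellV in b1 b2 b3.
have := thin w (g ^+ M.+1) (g ^- M.+1).
have := hyp1 w (g ^+ M.+1) g; have := hyp1 w (g ^- M.+1) g^-1.
have := hyp1 (g ^+ M.+1) (g ^- M.+1) g^-1.
have := (dle (g ^+ M.+1) (g ^- M.+1), dle w (g ^+ M.+1), dle w (g ^- M.+1)).
rewrite [d (g ^+ M.+1) w]dC [d (g ^- M.+1) w]dC [d (g ^- M.+1) (g ^+ M.+1)]dC.
rewrite xg xg' yg lw ly lx (ellV g).
move: (d w g) (d w g^-1) w1 w1' => p q w1 w1'.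
move: (d w (g ^+ M.+1)) (d w (g ^- M.+1)) (d (g ^+ M.+1) (g ^- M.+1)) => p' q' r.
move: (ell (g ^+ M)) (ell (g ^+ M.+1)) (ell (g ^+ M.+2)) a1 a2 a3 b1 b2 b3 => A B C a1 a2 a3
  b1 b2 b3.
move=> [[h0 h1] h2] h3 h4 h5.
(* [k1], [k2], [k3] bound the doubled Gromov products at [1] of [w], [g^(M+1)], [g^-(M+1)]: the
   point [1] is nearly a center. The first two come from the minimality of [h], tested only at its
   neighbours [h g] and [h g^-1]. *)
have k1 : (m + B <= p' + ell g + D)%N by clear -h5 w1 a1 a3 b3 P1; lia.
have k2 : (m + B <= q' + ell g + D)%N by clear -h4 w1' a1 a3 b3 P1; lia.
have k3 : (B + B <= r + s + D + D)%N by clear -h3 a1 a3 b3 P1; lia.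
by case/or3P; clear -lM a2 a3 P1 k1 k2 k3 h1 h2 h0; lia.
Qed.

(** Seen from its center, a fat triangle gives three long elements [a], [b], [c] with small pairwise
    Gromov products. By hyperbolicity [v] is nearly aligned with at most one of them; two others
    serve as children. *)
Lemma fork_exists L :
  (forall L, exists x y z, [/\ L <= gp x y z, L <= gp y x z & L <= gp z x y]%N) ->
  exists Lam (next : G -> bool -> G), forall v,
    (gp 1 (next v false) (next v true) <= D + 2)%N /\
    forall b, [/\ (L <= ell (next v b))%N, (ell (next v b) <= Lam)%N &
      (gp 1 v (next v b) <= D + 2 + D)%N].
Proof.
move=> /(_ (2 * L + 2)%N) [x [y [z [fx fy fz]]]].
have [p [pxy pyz pxz [px py pz]]] := approx_center x y z.
exists (d p x + d p y + d p z)%N.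
pose a := p^-1 * x; pose b := p^-1 * y; pose c := p^-1 * z.
have dp u v : d (p^-1 * u) (p^-1 * v) = d u v by rewrite dM.
have La : (L <= ell a)%N by rewrite /a; lia.
have Lb : (L <= ell b)%N by rewrite /b; lia.
have Lc : (L <= ell c)%N by rewrite /c; lia.
rewrite -(dp x y) -/a -/b -/c in pxy; rewrite -(dp x z) -/a -/b -/c in pxz.
rewrite -(dp y z) -/a -/b -/c in pyz; rewrite -/a -/b -/c.
suff fork v : exists w : G * G, (gp 1 w.1 w.2 <= D + 2)%N /\ forall e,
    let u := if e then w.2 else w.1 in
    [/\ (L <= ell u)%N, (ell u <= ell a + ell b + ell c)%N &
      (gp 1 v u <= D + 2 + D)%N].
  by have [f Hf] := choice fork; exists (fun v (e : bool) => if e then (f v).2 else (f v).1).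
have [va|va] := leqP (gp 1 v a) (D + 2 + D); last first.
  have := hyp1 a v b; have := hyp1 a v c; move: va pxy pyz pxz.
  rewrite [d a v]dC !d1 => va pxy pyz pxz h1 h2.
  by exists (b, c); rewrite /= !d1; split=> // -[]; split; rewrite /= ?d1; lia.
have [vb|vb] := leqP (gp 1 v b) (D + 2 + D); last first.
  have := hyp1 b v c; move: va vb pxy pyz pxz.
  rewrite [d b v]dC !d1 => va vb pxy pyz pxz h1.
  by exists (a, c); rewrite /= !d1; split=> // -[]; split; rewrite /= ?d1; lia.
move: va vb pxy; rewrite !d1 => va vb pxy.
by exists (a, b); rewrite /= !d1; split=> // -[]; split; rewrite /= ?d1; lia.
Qed.

(* [v] points back to where the last step came from; the two children avoid that direction,
   so paths in this binary tree never backtrack. *)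
Fixpoint leaf (next : G -> bool -> G) (v : G) (bs : bitseq) : G :=
  if bs is b :: bs' then next v b * leaf next (next v b)^-1 bs' else 1.

Section Leaves.
Variables (Lam : nat) (next : G -> bool -> G).
Hypothesis nextP : forall v,
    (gp 1 (next v false) (next v true) <= D + 2)%N /\
    forall b, [/\ (5 * D + 5 <= ell (next v b))%N, (ell (next v b) <= Lam)%N &
      (gp 1 v (next v b) <= D + 2 + D)%N].

Lemma ell_leaf v bs : (ell (leaf next v bs) <= size bs * Lam)%N.
Proof.
elim: bs v => [|b bs IH] v /=; first by rewrite ell1.
have [_ /(_ b) [_ h _]] := nextP v.
by rewrite mulSn (leq_trans (ellM _ _))// leq_add.
Qed.

(** Let [w] be the first step and [u] the rest. As [u] avoids [w^-1], the product [(w u | w)] is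
    large; as [v] avoids [w], it then avoids [w u]. Steps of length at least [5 D + 5] keep the
    error from accumulating. *)
Lemma leaf_away v bs : (gp 1 v (leaf next v bs) <= D + 2 + D + D)%N.
Proof.
elim: bs v => [|b bs IH] v /=; first by rewrite !d1 d1r ell1; lia.
have [_ /(_ b) [h1 h2 h3]] := nextP v.
have := IH (next v b)^-1; move: h1 h2 h3.
move: (next v b) (leaf next (next v b)^-1 bs) => w u.
have := hyp1 v (w * u) w; rewrite [d (w * u) w]dC dMl !d1 invgK ellV.
by move: (ell (w * u)) (d v (w * u)) (d v w) (ell w) (ell u) (ell v) => *; lia.
Qed.

(** At the first differing bit, a common end point would be aligned with both children, whose Gromov
    product is small. *)
Lemma leaf_inj v bs bs' : size bs = size bs' ->
  leaf next v bs = leaf next v bs' -> bs = bs'.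
Proof.
elim: bs v bs' => [|b bs IH] v [|b' bs'] //= [sz].
have [<-|neqb] := eqVneq b b'; first by move/mulgI/IH => ->.
have [h0 h] := nextP v; have [h1 h2 h3] := h b; have [h1' h2' h3'] := h b'.
have g0 : (gp 1 (next v b) (next v b') <= D + 2)%N.
  by case: b b' neqb h0 {h h1 h2 h3 h1' h2' h3' } => -[] // _; rewrite !d1 dC; lia.
have := leaf_away (next v b)^-1 bs; have := leaf_away (next v b')^-1 bs'.
move: (next v b) (next v b') h1 h2 h3 h1' h2' h3' g0 => w w' h1 h2 h3 h1' h2' h3' g0.
move: (leaf next w^-1 bs) (leaf next w'^-1 bs') => u u'.
rewrite !invgK !d1 !ellV => i1 i2 uu'.
have := hyp1 w (w * u) w'.
have -> : d w (w * u) = ell u by rewrite dMl.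
have -> : d (w * u) w' = ell u' by rewrite uu' dC dMl.
have e : ell (w * u) = ell (w' * u') by rewrite uu'.
rewrite -e in i1; move: h1 h2 h3 h1' h2' h3' g0 i1 i2; rewrite !d1.
by move: (ell (w * u)) (d w w') (d v w) (d v w') (ell w) (ell w') (ell u) (ell u') (ell v) =>
  *; lia.
Qed.

End Leaves.

Lemma exponential_growth :
  (forall L, exists x y z, [/\ L <= gp x y z, L <= gp y x z & L <= gp z x y]%N) ->
  exists Lam, forall m, (2 ^ m <= size (ball (m * Lam)))%N.
Proof.
move=> /(fork_exists (5 * D + 5)) [Lam [next nextP]]; exists Lam => m.
pose S := [seq leaf next 1 (tval t) | t : m.-tuple bool].
have <- : size S = (2 ^ m)%N by rewrite size_image card_tuple card_bool.
apply: uniq_leq_size.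
  rewrite map_inj_in_uniq ?enum_uniq// => t t' _ _ /leaf_inj tt'.
  by apply/val_inj/(tt' Lam); rewrite // !size_tuple.
move=> _ /mapP[t _ ->]; rewrite mem_ball.
by have := ell_leaf nextP 1 t; rewrite size_tuple.
Qed.

(* With the inner radius [2 k + 2 D] of the annulus, a shadow fits, up to translation, in the ball
   of radius [n - k]. *)
Lemma small_shadows Lam : (forall m, (2 ^ m <= size (ball (m * Lam)))%N) ->
  exists S : seq G, [/\ uniq S, forall a, a \in S -> a^-1 \in S &
    forall g, (2 * count (fun a => ell a <= gp 1 g a) S < size S)%N].
Proof.
move=> growth; pose k := (2 * Lam)%N; pose m := (2 * k + 2 * D)%N.
pose S n := [seq a <- ball n | (m < ell a)%N].
have shadow n g :
    (count (fun a => ell a <= gp 1 g a)%N (S n) <= size (ball (n - k)))%N.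
  rewrite -size_filter.
  (* An element this short casts no shadow on the annulus: a shadowed [a] has length at most
     [2 ell g <= m]. *)
  have [gm|gm] := leqP (ell g) (k + D).
    rewrite (@eq_in_filter _ _ pred0) ?filter_pred0// => a.
    rewrite mem_filter => /andP[ma _]; apply/negbTE; rewrite -ltnNge !d1.
    have := dT 1 g a; rewrite !d1; move: ma gm; rewrite /m.
    move: (d g a) (ell g) (ell a) => u v w; clearbody k; clear; lia.
  have [p [lp pg]] := ell_prefix (ltnW gm).
  rewrite -(size_map (fun a => p^-1 * a)).
  apply: uniq_leq_size.
    by rewrite map_inj_uniq ?filter_uniq//; exact: mulgI.
  move=> x /mapP[a]; rewrite !mem_filter mem_ball => /and3P[h1 h2 h3] ->.
  rewrite mem_ball; move: h1 gm h2 h3.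
  have := hyp1 a g p; rewrite [d g p]dC [d a p]dC !d1 [d a g]dC pg lp /m.
  move: (d g a) (ell g) (ell a) (d p a) => u v w z; clearbody k; clear; lia.
(* Balls grow at least like [4^j] in steps of [k = 2 Lam], so some step has a factor above [3]. One
   third pays for the removed inner ball; what remains exceeds twice the size of any shadow. *)
have /existsNP[j Hj] : ~ forall j, (size (ball (m + j.+1 * k)) <= 3 * size (ball (m + j * k)))%N.
  move=> H; set B := size (ball m).
  have H1 j : (4 ^ j <= 3 ^ j * B)%N.
    apply: (@leq_trans (size (ball (m + j * k)))).
      rewrite -[4%N]/(2 ^ 2)%N -expnM (leq_trans (growth _))//.
      apply: uniq_leq_size => // x; rewrite !mem_ball => /leq_trans; apply.
      by rewrite /k; clear; lia.
    elim: j => [|j IH]; first by rewrite mul0n addn0 expn0 mul1n.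
    by rewrite (leq_trans (H j))// expnS -mulnA leq_mul2l.
  have H2 j : (3 ^ j * (3 + j) <= 3 * 4 ^ j)%N.
    elim: j => // j IH; rewrite !expnS; move: IH.
    by move: (3 ^ j)%N (4 ^ j)%N => u v; clear; nia.
  have := H1 (3 * B)%N; have := H2 (3 * B)%N.
  have : (0 < 3 ^ (3 * B))%N by rewrite expn_gt0.
  by move: (3 ^ (3 * B))%N (4 ^ (3 * B))%N => u v; clear; nia.
exists (S (m + j.+1 * k)%N); split.
- by rewrite filter_uniq.
- by move=> a; rewrite !mem_filter !mem_ball !ellV.
move=> g; move/negP: Hj; rewrite -ltnNge => Hj.
have := shadow (m + j.+1 * k)%N g.
have -> : (m + j.+1 * k - k = m + j * k)%N by rewrite mulSn addnCA addKn.
have := count_predC (fun a => m < ell a)%N (ball (m + j.+1 * k)).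
have : (count (predC (fun a => m < ell a)) (ball (m + j.+1 * k)) <= size (ball (m + j * k)))%N.
  rewrite -size_filter; apply: uniq_leq_size; first by rewrite filter_uniq.
  move=> x; rewrite mem_filter !mem_ball /= -leqNgt => /andP[h _].
  by rewrite (leq_trans h)// leq_addr.
move=> h1 h2 h3; have h4 : size (S (m + j.+1 * k)%N) =
    count (fun a => m < ell a)%N (ball (m + j.+1 * k)) by rewrite size_filter.
by move: h1 h2 h3 h4 Hj; clear; lia.
Qed.

(** Either there are triangles of every fatness, hence exponential growth, or fatness is bounded and
    [G] lies near a cyclic subgroup, against the second hypothesis. *)
Lemma schottky_set : (forall m, exists g, (m < ell g)%N) ->
  (forall g R, ~ forall z, exists h,
    (exists n : nat, h = g ^+ n \/ h = g ^- n) /\ (d h z <= R)%N) ->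
  exists S : seq G, [/\ uniq S, forall a, a \in S -> a^-1 \in S &
    forall g, (2 * count (fun a => ell a <= gp 1 g a) S < size S)%N].
Proof.
move=> unbdd noncyc.
have [L|Lam growth] := exponential_growth; last exact: small_shadows growth.
apply: contrapT => nofat.
have [x y z|g [R gR]] := @thin_quasi_cyclic L unbdd; last exact: (noncyc g R).
rewrite !ltnNge -!negb_and; apply/negP => /and3P[h1 h2 h3].
by apply: nofat; exists x, y, z.
Qed.

End WordGeometry.

Local Open Scope classical_set_scope.
Local Open Scope ring_scope.

(** * Non-amenability *)

Lemma perm_filter_mem (T : eqType) (s t : seq T) :
  uniq s -> uniq t -> {subset t <= s} -> perm_eq [seq x <- s | x \in t] t.
Proof.
move=> us ut ts; apply: uniq_perm; rewrite ?filter_uniq// => x.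
by rewrite mem_filter andb_idr//; exact: ts.
Qed.

Lemma sum_support (R : nmodType) (T : eqType) (s t : seq T) (P : pred T) (F : T -> R) :
  uniq s -> uniq t -> {subset t <= s} -> (forall x, x \notin t -> F x = 0) ->
  \sum_(x <- s | P x) F x = \sum_(x <- t | P x) F x.
Proof.
move=> us ut ts F0; rewrite (bigID (mem t)) /= [X in _ + X]big1 ?addr0; last first.
  by move=> x /andP[_]; exact: F0.
rewrite (eq_bigl _ _ (fun x => andbC (P x) (x \in t))) -big_filter_cond.
by apply: perm_big; exact: perm_filter_mem.
Qed.

Lemma ler_sum_uniq (R : numDomainType) (T : eqType) (s t : seq T) (F : T -> R) :
  uniq s -> uniq t -> {subset s <= t} -> (forall x, 0 <= F x) ->
  \sum_(x <- s) F x <= \sum_(x <- t) F x.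
Proof.
move=> us ut st F0; rewrite [leRHS](bigID (fun x => x \in s) predT)/= -[X in _
  <= X + _]big_filter.
by rewrite (perm_big _ (perm_filter_mem ut us st)) lerDl sumr_ge0.
Qed.

Section Nonamenable.
Variables (R : realFieldType) (G : groupType) (S : seq G) (pos neg : G -> pred G).
Local Notation "x *g y" := (x * y)%g (at level 40).
Hypothesis ping_pong : forall a g, ~~ neg a g -> pos a (a * g)%g.
Hypothesis small : forall g,
  (count (pos^~ g) S + count (neg^~ g) S < size S)%N.

(* If all the translations almost preserved [f], then [f^2] would give [pos a] and [neg a] together
   almost full mass for every [a] in [S], against [small]. *)
Lemma nonamenable : exists2 kappa : R, 0 < kappa &
  forall (f : G -> R) (t : seq G), uniq t -> (forall g, g \notin t -> f g = 0) ->
  exists2 a, a \in S & exists2 s : seq G, uniq s &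
  kappa * (\sum_(g <- t) f g ^+ 2) <= \sum_(g <- s) (f (a * g)%g - f g) ^+ 2.
Proof.
have n0 : (0 < size S)%N by apply: leq_ltn_trans (small 1%g).
set n := size S in n0 *.
(* Each of the [n] elements of [S] loses at most [2 eta T0], together [T0 / 2], whereas [small]
   forces a total loss of at least [T0]. *)
have [eta etaE] : exists eta : R, eta = (4 * n%:R)^-1 by eexists.
have nR : (0 : R) < n%:R by rewrite ltr0n.
have eta0 : 0 < eta by rewrite etaE invr_gt0 mulr_gt0.
exists (eta ^+ 2) => [|f t ut f0]; first exact: exprn_gt0.
pose m (P : pred G) := \sum_(g <- t | P g) f g ^+ 2.
set T0 := \sum_(g <- t) _.
have T0ge : 0 <= T0 by apply: sumr_ge0 => g _; exact: sqr_ge0.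
apply: contrapT => no.
have H a s : a \in S -> uniq s -> \sum_(g <- s) (f (a * g)%g - f g) ^+ 2 < eta ^+ 2 * T0.
  move=> aS us; rewrite ltNge; apply/negP => h; apply: no; exists a => //; exists s => //.
have F0 g : g \notin t -> f g ^+ 2 = 0 by move=> /f0 ->; rewrite expr0n.
have key a : a \in S -> T0 - m (neg a) - m (pos a) <= 2 * eta * T0.
  (* Off this list both [f g] and [f (a g)] vanish. *)
  move=> aS; pose s := undup (t ++ [seq (a^-1 * g)%g | g <- t]).
  have us : uniq s by exact: undup_uniq.
  have ts : {subset t <= s} by move=> g gt; rewrite mem_undup mem_cat gt.
  have e1 : T0 - m (neg a) = \sum_(g <- s | ~~ neg a g) f g ^+ 2.
    by rewrite (sum_support _ us ut ts F0) /T0 /m (bigID (neg a) predT)/= addrAC subrr add0r.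
  have e2 : \sum_(g <- s | ~~ neg a g) f (a * g)%g ^+ 2 <= m (pos a).
    have -> : m (pos a) = \sum_(g <- [seq (a * g)%g | g <- s] | pos a g) f g ^+ 2.
      apply/esym/sum_support => //; first by rewrite map_inj_uniq//; exact: mulgI.
      move=> g gt; apply/mapP; exists (a^-1 * g)%g; last by rewrite mulVKg.
      by rewrite mem_undup mem_cat map_f ?orbT.
    rewrite big_map [leRHS](bigID (neg a)) /= addrC.
    apply: (@le_trans _ _ (\sum_(g <- s | pos a (a * g)%g && ~~ neg a g) f (a * g)%g ^+ 2)).
      rewrite le_eqVlt; apply/orP; left; apply/eqP; apply: eq_bigl => g.
      by case: (boolP (neg a g)) => [|/ping_pong ->]; rewrite ?andbF.
    by rewrite lerDl sumr_ge0// => g _; exact: sqr_ge0.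
  (* Weighted Young inequality [x^2 <= y^2 + eta x^2 + eta^-1 (x - y)^2], obtained by completing a
     square. *)
  have e3 : \sum_(g <- s | ~~ neg a g) f g ^+ 2 <=
     \sum_(g <- s | ~~ neg a g) f (a * g)%g ^+ 2
     + eta * (\sum_(g <- s) f g ^+ 2) + eta^-1 * \sum_(g <- s) (f (a * g)%g - f g) ^+ 2.
    rewrite !mulr_sumr -addrA -big_split/= -lerBlDl -sumrB.
    apply: (@le_trans _ _ (\sum_(g <- s | ~~ neg a g)
       (eta * f g ^+ 2 + eta^-1 * (f (a * g)%g - f g) ^+ 2))).
      apply: ler_sum => g _; move: (f g) (f (a * g)%g) => x y.
      have : 0 <= eta * (x - eta^-1 * (x - y)) ^+ 2 by apply: mulr_ge0;
        [exact: ltW | exact: sqr_ge0].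
      have := divff (lt0r_neq0 eta0); move: (eta^-1) => z ez h.
      have : eta * (x - z * (x - y)) ^+ 2 =
        eta * x ^+ 2 - 2 * (eta * z) * x * (x - y) + (eta * z) * z * (x - y) ^+ 2 by ring.
      by rewrite ez => E; rewrite E in h; have := sqr_ge0 (x - y); nra.
    rewrite [leRHS](bigID (neg a))/= lerDr sumr_ge0// => g _.
    by apply: addr_ge0; apply: mulr_ge0; rewrite ?sqr_ge0 ?invr_ge0 ?(ltW eta0).
  have e4 : \sum_(g <- s) f g ^+ 2 = T0 by rewrite (sum_support predT us ut ts F0).
  have := H a s aS us; move: e3; rewrite -e1 e4 => e3 e5.
  have : eta^-1 * \sum_(g <- s) (f (a * g)%g - f g) ^+ 2 <= eta * T0.
    by rewrite [leLHS]mulrC ler_pdivrMr// mulrAC -expr2; exact: ltW.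
  move=> e6; have := lerD e2 e6; lra.
have : \sum_(a <- S) (T0 - 2 * eta * T0) <= \sum_(a <- S) (m (neg a) + m (pos a)).
  rewrite big_seq [leRHS]big_seq; apply: ler_sum => a /key; lra.
have -> : \sum_(a <- S) (m (neg a) + m (pos a)) =
    \sum_(g <- t) (count (pos^~ g) S + count (neg^~ g) S)%:R * f g ^+ 2.
  have E (Q : G -> pred G) : \sum_(a <- S) m (Q a) = \sum_(g <- t) (count (Q^~ g) S)%:R * f g
    ^+ 2.
    rewrite /m (exchange_big_dep predT)//=; apply: eq_bigr => g _.
    by rewrite big_const_seq iter_addr_0 mulr_natl.
  rewrite big_split/= !E -big_split/=; apply: eq_bigr => g _.
  by rewrite addnC natrD mulrDl.
have : \sum_(g <- t) (count (pos^~ g) S + count (neg^~ g) S)%:R * f g ^+ 2 <=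
    \sum_(g <- t) (n%:R - 1) * f g ^+ 2.
  apply: ler_sum => g _; rewrite ler_wpM2r ?sqr_ge0//.
  by rewrite lerBrDr natr1 ler_nat; exact: small.
rewrite -mulr_sumr -/T0 big_const_seq count_predT iter_addr_0 -/n => h1 h2.
have := le_trans h2 h1; rewrite -(mulr_natl (T0 - _) n).
have -> : n%:R * (T0 - 2 * eta * T0) = n%:R * T0 - T0 / 2.
  rewrite etaE; field; exact: lt0r_neq0.
have [T00|T0n0] := eqVneq T0 0; last first.
  have : 0 < T0 by rewrite lt_neqAle eq_sym T0n0.
  by move=> ? ?; lra.
have [a aS] : exists a, a \in S by move: n0; rewrite /n; case: S => // a ? _; exists a;
  rewrite mem_head.
by have := H a [::] aS isT; rewrite big_nil T00 mulr0 ltxx.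
Qed.

End Nonamenable.

(** * Word length as a natural number *)

Section WordLength.
Variables (R : realType) (G : groupType) (E : seq G).
Hypothesis symE : symmetric_generating E.
Local Notation word w g := (word_in E w /\ (\prod_(s <- w) s)%g = g).

Lemma shortest_word : exists ell : G -> nat, forall g,
  (exists w, word w g /\ size w = ell g) /\ (forall w, word w g -> (ell g <= size w)%N).
Proof.
have [_ genE] := symE.
suff H g : exists n : nat, (exists w, word w g /\ size w = n) /\ (forall w, word w g -> (n
  <= size w)%N).
  by have [f Hf] := choice H; exists f.
have exP : exists n, `[< exists w, word w g /\ size w = n >].
  by have [w w1 w2] := genE g; exists (size w); apply/asboolP; exists w.
case: (ex_minnP exP) => n /asboolP wn nmin; exists n; split => // w wg.
by apply: nmin; apply/asboolP; exists w.
Qed.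

Lemma word_cat u v g h : word u g -> word v h -> word (u ++ v) (g * h)%g.
Proof. by move=> [uE <-] [vE <-]; rewrite /word_in all_cat big_cat; split=> //; apply/andP. Qed.

Lemma word_inv u g : word u g -> word (rev [seq x^-1%g | x <- u]) g^-1%g.
Proof.
have [invE _] := symE; move=> [uE <-]; split.
  by rewrite /word_in all_rev all_map; apply: sub_all uE => x; exact: invE.
elim: u {uE} => [|x u IH]; first by rewrite !big_nil invg1.
by rewrite /= rev_cons -cats1 big_cat big_seq1 IH big_cons invgM.
Qed.

(** The infimum is attained by a shortest word, whose prefixes are geodesic. Each ball consists of
    the previous one and its translates by [E], whence the factor [size E + 1]. *)
Lemma word_length_nat : exists (ell : G -> nat) (ball : nat -> seq G),
  [/\ [/\ ell 1%g = 0%N, forall x, ell x^-1%g = ell x &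
          forall x y, (ell (x * y)%g <= ell x + ell y)%N],
      forall g k, (k <= ell g)%N ->
        exists p, ell p = k /\ ell (p^-1 * g)%g = (ell g - k)%N,
      [/\ forall n g, (g \in ball n) = (ell g <= n)%N, forall n, uniq (ball n) &
          forall n, (size (ball n) <= (size E).+1 ^ n)%N] &
      forall g, word_length R E g = (ell g)%:R].
Proof.
have [invE genE] := symE; have [ell Hell] := shortest_word.
have ellP w g : word w g -> (ell g <= size w)%N by move/(proj2 (Hell g)).
have ellW g : exists w, word w g /\ size w = ell g by exact: (proj1 (Hell g)).
have ell1 : ell 1%g = 0%N.
  by apply/eqP; rewrite -leqn0; apply: (ellP [::]); rewrite /word_in big_nil.
have ellV_le x : (ell x^-1%g <= ell x)%N.
  by have [w [/word_inv/ellP h <-]] := ellW x; rewrite size_rev size_map in h.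
have ellV x : ell x^-1%g = ell x.
  by apply/eqP; rewrite eqn_leq ellV_le -{1}(invgK x) ellV_le.
have ellM x y : (ell (x * y)%g <= ell x + ell y)%N.
  have [u [hu <-]] := ellW x; have [v [hv <-]] := ellW y.
  by rewrite -size_cat; apply/ellP/word_cat.
have pref g k : (k <= ell g)%N ->
    exists p, ell p = k /\ ell (p^-1 * g)%g = (ell g - k)%N.
  have [w [[wE wg] sw]] := ellW g; rewrite -{1}sw => kw.
  pose p := (\prod_(s <- take k w) s)%g; pose q := (\prod_(s <- drop k w) s)%g.
  have /andP[tE dE] : all (mem E) (take k w) && all (mem E) (drop k w).
    by rewrite -all_cat cat_take_drop.
  have pq : (p * q)%g = g by rewrite -wg -[w in RHS](cat_take_drop k) big_cat.
  have hp : (ell p <= k)%N.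
    by rewrite -[leqRHS](size_takel kw); apply: ellP; split.
  have hq : (ell q <= size w - k)%N by rewrite -size_drop; apply: ellP; split.
  have qE : (p^-1 * g)%g = q by rewrite -pq mulKg.
  by have := ellM p q; rewrite pq; exists p; rewrite qE; split; lia.
pose ball := fix ball n := if n is n'.+1 then
  undup (ball n' ++ [seq (s * g)%g | s <- E, g <- ball n']) else [:: 1%g : G].
have eltE s : s \in E -> (ell s <= 1)%N.
  by move=> sE; apply: (ellP [:: s]); rewrite /word_in/= sE big_seq1.
exists ell, ball; split=> //.
- split.
  + elim=> [|n IH] g /=.
      rewrite inE leqn0; apply/eqP/eqP => [->|g0]; first exact: ell1.
      have [w [[_ wg] sw]] := ellW g; rewrite g0 in sw.
      by rewrite -wg (size0nil sw) big_nil.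
    rewrite mem_undup mem_cat IH; apply/orP/idP => [[/leqW//|]|].
      move=> /allpairsP[[s h] /= [sE hb ->]]; rewrite IH in hb.
      by rewrite (leq_trans (ellM _ _))// -add1n leq_add ?eltE.
    have [w [[wE wg] <-]] := ellW g.
    case: w wE wg => [_ wg|s w /andP[sE wE]]; first by left.
    rewrite big_cons => wg sw; right; apply/allpairsP.
    exists (s, \prod_(i <- w) i)%g; split => //=; rewrite IH.
    rewrite /= ltnS in sw; apply: (leq_trans _ sw); apply: ellP; split=> //; exact: wE.
  + by case=> [//|n] /=; exact: undup_uniq.
  + elim=> [//|n IH] /=; rewrite (leq_trans (size_undup _))// size_cat size_allpairs.
    by rewrite -mulSn expnS leq_mul2l IH orbT.
move=> g; rewrite /word_length.
have [w [hw sw]] := ellW g.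
apply/eqP; rewrite eq_le; apply/andP; split.
  apply: ge_inf; last by exists w => //; rewrite sw.
  by exists 0 => _ [v _ <-].
apply: lb_le_inf; first by exists (size w)%:R; exists w.
by move=> _ [v /ellP h <-]; rewrite ler_nat.
Qed.

End WordLength.

(** Clearing the halves in the Gromov products gives the four-point condition; [D] is any natural
    number above [2 delta]. *)
Lemma hyperbolic_nat (R : realType) (G : groupType) (E : seq G) (ell : G -> nat) :
  (forall g, word_length R E g = (ell g)%:R) -> gromov_hyperbolic (word_dist R E) ->
  exists D : nat, forall w x y z : G,
  (ell (x^-1 * z)%g + ell (w^-1 * y)%g <=
   maxn (ell (x^-1 * y)%g + ell (w^-1 * z)%g) (ell (y^-1 * z)%g + ell (w^-1 * x)%g) + D)%N.
Proof.
move=> ellE [delta hyp]; have [D hD] : exists D : nat, 2 * delta <= D%:R.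
  exists (Num.bound `|2 * delta|).
  by rewrite (le_trans (ler_norm _))// ltW// archi_boundP.
exists D => w x y z; have := hyp w x y z.
rewrite /gromov_product /word_dist !ellE.
move: (ell _) (ell _) (ell _) (ell _) (ell _) (ell _) => a b c d e f.
rewrite -(ler_nat R) !natrD natr_max !natrD.
case: (leP ((f%:R + e%:R - d%:R) / 2 : R)) => h1; case: (leP (d%:R + c%:R : R)) => h2 h3; lra.
Qed.

Lemma cyclic_subgroupM (G : groupType) (g x y : G) :
  cyclic_subgroup g x -> cyclic_subgroup g y -> cyclic_subgroup g (x * y)%g.
Proof.
move=> [m [->|->]] [n [->|->]].
- by exists (m + n)%N; left; rewrite expgnDr.
- exact: mulgXV.
- have [j [Hj|Hj]] := mulgXV g^-1%g m n; exists j; [right|left].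
    by rewrite -!expVgn -Hj !expVgn invgK.
  by rewrite -[g in RHS]invgK expVgn -Hj !expVgn invgK.
- by exists (n + m)%N; right; rewrite expgnDr invgM.
Qed.

Lemma cyclic_subgroupV (G : groupType) (g x : G) :
  cyclic_subgroup g x -> cyclic_subgroup g x^-1%g.
Proof. by move=> [m [->|->]]; exists m; [right|left; rewrite invgK]. Qed.

Lemma hyperbolic_nonamenable (R : realType) (G : groupType) :
  word_hyperbolic R G -> non_elementary G ->
  exists (S : seq G) (kappa : R), 0 < kappa /\
  forall (f : G -> R) (t : seq G), uniq t -> (forall g, g \notin t -> f g = 0) ->
  exists2 a, a \in S & exists2 s : seq G, uniq s &
  kappa * (\sum_(g <- t) f g ^+ 2) <= \sum_(g <- s) (f (a * g)%g - f g) ^+ 2.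
Proof.
move=> [E symE hyp] [infG notvc].
have [ell [ball [[ell1 ellV ellM] pref [mem_ball ball_uniq _] ellE]]] := word_length_nat R symE.
have [D hD] := hyperbolic_nat ellE hyp.
have unbdd m : exists g, (m < ell g)%N.
  apply: contrapT => nog; apply: infG.
  apply: (@sub_finite_set _ _ [set` ball m]) => // g _ /=.
  by rewrite mem_ball leqNgt; apply/negP => h; apply: nog; exists g.
have [] := schottky_set ell1 ellV ellM pref mem_ball ball_uniq hD unbdd.
  move=> g r cov; apply: notvc; exists g.
  pose coset (x : G) := [set (x * h)%g | h in cyclic_subgroup g].
  apply: (@sub_finite_set _ _ (coset @` [set` ball r])); last exact: finite_image.
  (* [cov] gives right cosets of the cyclic subgroup with representatives in a ball; inversion turns
     them into left cosets. *)
  move=> _ [x _ <-]; have [h [[n hn] hr]] := cov x^-1%g.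
  exists (h^-1 * x^-1)^-1%g => /=; first by rewrite mem_ball ellV.
  have Hh : cyclic_subgroup g h by exists n.
  rewrite /coset invgM !invgK; apply/seteqP; split=> _ [k Hk <-].
    by exists (h * k)%g; [exact: cyclic_subgroupM|rewrite mulgA].
  exists (h^-1 * k)%g; last by rewrite mulgA mulgK.
  by apply: cyclic_subgroupM => //; exact: cyclic_subgroupV.
move=> S [uS VS small]; exists S.
pose pos a := [pred g | ell a <= ell g + ell a - ell (g^-1 * a)%g]%N.
have [a g|g|kappa k0 H] := @nonamenable R G S pos (fun a => pos a^-1%g).
- rewrite /= -ltnNge invgM -mulgA mulVg mulg1 !ellV => h.
  have e : ell (g^-1 * a^-1)%g = ell (a * g)%g by rewrite -ellV invgM !invgK.
  have := h : (ell g + ell a - ell (g^-1 * a^-1)%g < ell a)%N; rewrite e.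
  by move: (ell (a * g)%g) (ell g) (ell a) => u v w; clear; lia.
- have -> : count (fun a => pos a^-1%g g) S = count (pos^~ g) S.
    rewrite -(count_map (fun a => a^-1%g) (pos^~ g)).
    apply/permP/uniq_perm => //; first by rewrite map_inj_uniq //; exact: invg_inj.
    move=> a; apply/mapP/idP => [[b bS ->]|aS]; first exact: VS.
    by exists a^-1%g; rewrite ?invgK //; exact: VS.
  rewrite addnn -mul2n; have := small g; congr (2 * _ < _)%N.
  by apply: eq_count => a; rewrite /pos /= invg1 !mul1g.
by exists kappa; split.
Qed.

(** * The transfer operator *)

Section InverseBranches.
Variables (A : finType) (X : sft A).
Local Notation Sigma := (sft_space X).

Definition cons_seq (a : A) (xi : Sigma) : full_shift A :=
  fun n => if n is m.+1 then letter xi m else a.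

Definition allowed (a : A) (xi : Sigma) := cons_seq a xi \in avoiding (forbidden X).

(* Junk value [xi] if [a] cannot be prepended; [branch_weight] vanishes there. *)
Definition prep (a : A) (xi : Sigma) : Sigma :=
  if pselect (allowed a xi) is left h then SigSub h else xi.

Lemma letter_inj (xi eta : Sigma) : (forall n, letter xi n = letter eta n) -> xi = eta.
Proof. by move=> h; apply: val_inj; apply/funext=> n; exact: h. Qed.

Lemma letter_prep0 a xi : allowed a xi -> letter (prep a xi) 0 = a.
Proof. by rewrite /prep; case: pselect. Qed.

Lemma letter_prepS a xi n : allowed a xi -> letter (prep a xi) n.+1 = letter xi n.
Proof. by rewrite /prep; case: pselect. Qed.

Lemma letter_shift (xi : Sigma) n : letter (sft_shift xi) n = letter xi n.+1.
Proof. by []. Qed.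

Lemma shift_prep a xi : allowed a xi -> sft_shift (prep a xi) = xi.
Proof. by move=> h; apply: letter_inj => n; rewrite letter_shift letter_prepS. Qed.

Lemma allowed_shift (xi : Sigma) : allowed (letter xi 0) (sft_shift xi).
Proof.
rewrite /allowed; have -> : cons_seq (letter xi 0) (sft_shift xi) = \val xi.
  by apply/funext => -[|n].
exact: valP.
Qed.

Lemma prep_shift (xi : Sigma) : prep (letter xi 0) (sft_shift xi) = xi.
Proof.
have h := allowed_shift xi; apply: letter_inj => -[|n].
  by rewrite letter_prep0.
by rewrite letter_prepS.
Qed.

Lemma letter_iter_shift (xi : Sigma) n i : letter (iter n (@sft_shift A X) xi) i = letter xi
  (n + i).
Proof. by elim: n i => // n IH i; rewrite iterS letter_shift IH addSnnS. Qed.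

Definition agree (k : nat) (xi eta : Sigma) := forall i, (i < k)%N -> letter xi i = letter eta i.

Lemma agree_sym k xi eta : agree k xi eta -> agree k eta xi.
Proof. by move=> h i /h. Qed.

Lemma agree_prep a k xi eta : allowed a xi -> allowed a eta ->
  agree k xi eta -> agree k.+1 (prep a xi) (prep a eta).
Proof.
by move=> h1 h2 h [|i] ik; rewrite ?letter_prep0// !letter_prepS//; exact: h.
Qed.

Definition memory := \max_(w <- forbidden X) size w.

Lemma allowed_agree a xi eta : agree memory xi eta -> allowed a xi -> allowed a eta.
Proof.
move=> ag /set_mem al; apply/mem_set => w wF [|i] => [|wE]; last first.
  have /set_mem/(_ w wF i) := valP eta; exact.
have wm : (size w <= memory)%N by rewrite /memory; apply: leq_bigmax_seq.
move=> wE; apply: (al w wF 0%N); rewrite -[RHS]wE.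
apply/eq_in_map => -[|j]; rewrite mem_iota ?add0n//= => jw.
by apply: ag; rewrite (leq_trans _ wm)// ltnW.
Qed.

Section Transfer.
Variables (R : realType) (phi : Sigma -> R) (G : groupType) (gamma : A -> G).
Hypothesis normphi : normalized phi.

Definition branch_weight a xi := if allowed a xi then expR (phi (prep a xi)) else 0.

Lemma branch_weight_ge0 a xi : 0 <= branch_weight a xi.
Proof. by rewrite /branch_weight; case: ifP => _; rewrite ?expR_ge0. Qed.

Lemma sum_branch_weight xi : \sum_a branch_weight a xi = 1.
Proof.
rewrite -(normphi xi).
have -> : @sft_shift A X @^-1` [set xi] = (prep^~ xi) @` [set a | allowed a xi].
  apply/seteqP; split => [eta /= <-|_ [a /= h <-]]; last exact: shift_prep.
  by exists (letter eta 0); [exact: allowed_shift|exact: prep_shift].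
rewrite fsbig_image; last first.
  move=> a b /set_mem ha /set_mem hb ab.
  by rewrite -(letter_prep0 ha) ab letter_prep0.
rewrite fsbig_finite; last exact: finite_finset.
rewrite -big_mkcond/= -big_filter; apply: perm_big; apply: uniq_perm.
- by rewrite filter_uniq // index_enum_uniq.
- exact: finmap.fset_uniq.
move=> a; rewrite mem_filter mem_index_enum andbT in_fset_set; last exact: finite_finset.
by apply/idP/idP => [h|/set_mem//]; exact: mem_set.
Qed.

(** Letters are prepended, so the cocycle grows by left multiplication: the [n]-th iterate at
    [(xi, 1)] averages [h eta (cocycle gamma n eta)] over the [n]-th preimages [eta] of [xi]. *)
Definition transfer_operator (h : Sigma -> G -> R) (xi : Sigma) (g : G) : R :=
  \sum_a branch_weight a xi * h (prep a xi) (gamma a * g)%g.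

Local Notation transfer := transfer_operator.

(* Different group elements may only be reached by words of different lengths, for instance when
   [G] has a quotient [Z/2] in which every letter is odd; laziness removes this periodicity. *)
Definition lazy_operator h xi g : R := (h xi g + transfer h xi g) / 2.

Local Notation lazy := lazy_operator.

Lemma transfer_le h k : (forall xi g, h xi g <= k xi g) ->
  forall xi g, transfer h xi g <= transfer k xi g.
Proof.
by move=> hk xi g; apply: ler_sum => a _; rewrite ler_wpM2l ?branch_weight_ge0.
Qed.

Lemma transfer_lin c h k xi g :
  transfer (fun eta g => c * h eta g + k eta g) xi g = c * transfer h xi g + transfer k xi g.
Proof.
rewrite /transfer_operator mulr_sumr -big_split/=; apply: eq_bigr => a _.
by rewrite mulrDr mulrCA.
Qed.

Lemma transfer_const c xi g : transfer (fun _ _ => c) xi g = c.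
Proof. by rewrite /transfer_operator -mulr_suml sum_branch_weight mul1r. Qed.

Lemma lazy_le h k : (forall xi g, h xi g <= k xi g) ->
  forall xi g, lazy h xi g <= lazy k xi g.
Proof. by move=> hk xi g; rewrite ler_pM2r ?lerD ?transfer_le. Qed.

Lemma lazy_lin c h k xi g :
  lazy (fun eta g => c * h eta g + k eta g) xi g = c * lazy h xi g + lazy k xi g.
Proof. by rewrite /lazy_operator transfer_lin; ring. Qed.

Lemma lazy_const c xi g : lazy (fun _ _ => c) xi g = c.
Proof. by rewrite /lazy_operator transfer_const; field. Qed.

Lemma iter_lazy_le n h k : (forall xi g, h xi g <= k xi g) ->
  forall xi g, iter n lazy h xi g <= iter n lazy k xi g.
Proof. by elim: n h k => // n IH h k hk xi g; rewrite !iterS; apply: lazy_le; exact: IH. Qed.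

Lemma iter_lazy_lin n c h k xi g :
  iter n lazy (fun eta g => c * h eta g + k eta g) xi g =
  c * iter n lazy h xi g + iter n lazy k xi g.
Proof.
elim: n xi g => // n IH xi g; rewrite !iterS -lazy_lin; congr (lazy _ xi g).
by apply/funext => eta; apply/funext => g'; rewrite IH.
Qed.

Lemma iter_lazy_const n c xi g : iter n lazy (fun _ _ => c) xi g = c.
Proof.
elim: n xi g => // n IH xi g; rewrite iterS -[RHS](lazy_const c xi g).
by congr (lazy _ xi g); apply/funext => eta; apply/funext => g'; rewrite IH.
Qed.

Lemma iter_lazy_ge0 n h : (forall xi g, 0 <= h xi g) -> forall xi g, 0 <= iter n lazy h xi g.
Proof. by move=> h0 xi g; rewrite -(iter_lazy_const n 0 xi g) iter_lazy_le. Qed.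

End Transfer.
End InverseBranches.

(** * Distortion along cylinders and lower bounds for transitions *)

Section Hits.
Variables (A : finType) (X : sft A) (R : realType) (phi : sft_space X -> R).
Variables (G : groupType) (gamma : A -> G).
Local Notation Sigma := (sft_space X).
Local Notation weight := (branch_weight phi).
Local Notation lazy := (lazy_operator phi gamma).
Local Notation transfer := (transfer_operator phi gamma).

Lemma hoelder_geometric : hoelder_continuous phi ->
  exists C r : R, [/\ 0 <= C, 0 < r, r < 1 & forall k xi eta,
    agree k xi eta -> `|phi xi - phi eta| <= C * r ^+ k].
Proof.
move=> [alpha [C [a0 a1 H]]]; exists `|C|, (2^-1 `^ alpha); split.
- exact: normr_ge0.
- by rewrite powR_gt0 ?invr_gt0.
- by rewrite -[ltRHS](congr1 (@^~ alpha) (powR1 R)) gt0_ltr_powR ?nnegrE ?invr_ge0// invf_lt1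
  ?ltr1n.
move=> k xi eta ag; apply: le_trans (H xi eta) _.
apply: (@le_trans _ _ (`|C| * sft_dist R xi eta `^ alpha)).
  by rewrite ler_wpM2r ?powR_ge0// ler_norm.
rewrite ler_wpM2l//.
have -> : (2^-1 `^ alpha) ^+ k = (2^-1 ^+ k) `^ alpha :> R.
  by rewrite -[LHS]powR_mulrn ?powR_ge0// -powRrM mulrC powRrM powR_mulrn// invr_ge0.
have d0 : 0 <= sft_dist R xi eta.
  apply: lb_le_inf; first by exists 1; exists 0%N => //; rewrite expr0.
  by move=> _ [n _ <-]; rewrite exprn_ge0.
apply: ge0_ler_powR; rewrite ?nnegrE ?exprn_ge0 ?(ltW a0)//.
rewrite /sft_dist; apply: ge_inf; last by exists k.
by exists 0 => _ [n _ <-]; rewrite exprn_ge0.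
Qed.

(** Log-Hölder distortion, uniform in [g]. Only cylinders of length at least [memory X] count: on
    these the same letters can be prepended. *)
Definition cone (D r : R) (h : Sigma -> G -> R) :=
  (forall xi g, 0 <= h xi g) /\
  forall k xi eta g, (memory X <= k)%N -> agree k xi eta ->
    h xi g <= expR (D * r ^+ k) * h eta g.

Lemma agree_le j k xi eta : (j <= k)%N -> agree k xi eta -> @agree A X j xi eta.
Proof. by move=> jk ag i ij; apply: ag; exact: leq_trans jk. Qed.

(** Prepending a letter lengthens the agreement by one, so weight and function together are
    distorted by [(C + D) r^(k+1) <= D r^k]. *)
Lemma cone_lazy (C r D : R) h : 0 <= C -> 0 < r -> 0 <= D ->
  (forall k xi eta, agree k xi eta -> `|phi xi - phi eta| <= C * r ^+ k) ->
  (C + D) * r <= D ->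
  cone D r h -> cone D r (lazy h).
Proof.
move=> C0 r0 D0 hphi CD [h0 hD]; split=> [xi g|k xi eta g mk ag].
  apply: divr_ge0 => //; apply: addr_ge0 => //; apply: sumr_ge0 => a _.
  by rewrite mulr_ge0 ?branch_weight_ge0.
rewrite /lazy_operator mulrA ler_pM2r ?invr_gt0// mulrDr lerD ?hD//.
rewrite /transfer_operator mulr_sumr; apply: ler_sum => a _.
have agm : agree (memory X) xi eta by exact: agree_le ag.
rewrite /branch_weight; have [al|nal] := boolP (allowed a xi); last first.
  by rewrite mul0r mulr_ge0 ?expR_ge0 ?mulr_ge0//; case: ifP => // _; exact: expR_ge0.
have al' := allowed_agree agm al; rewrite al'.
have ag' := agree_prep al al' ag.
have h1 := hD k.+1 _ _ (gamma a * g)%g (leqW mk) ag'.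
have h2 : phi (prep a xi) <= C * r ^+ k.+1 + phi (prep a eta).
  by have := hphi _ _ _ ag'; rewrite ler_norml; lra.
have h3 : expR (phi (prep a xi)) <= expR (C * r ^+ k.+1) * expR (phi (prep a eta)).
  by rewrite -expRD ler_expR.
apply: le_trans (ler_pM (expR_ge0 _) (h0 _ _) h3 h1) _.
have -> : forall x y z w : R, x * y * (z * w) = (x * z) * (y * w) by move=> *; ring.
rewrite ler_wpM2r ?mulr_ge0 ?expR_ge0// -expRD ler_expR -mulrDl exprS mulrA.
by rewrite ler_wpM2r// exprn_ge0// ltW.
Qed.

Lemma cone_indicator (D r : R) (B : seq G) : 0 < r -> 0 <= D ->
  cone D r (fun _ g => (g \in B)%:R).
Proof.
move=> r0 D0; split=> // k xi eta g _ _.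
rewrite -[leLHS]mul1r ler_wpM2r// -[leLHS]expR0 ler_expR.
by rewrite mulr_ge0// exprn_ge0// ltW.
Qed.

(** In terms of test functions: for every [g], the [n]-step lazy walk from [(xi, g)] charges the
    point [(eta, s g)] with mass at least [q]. *)
Definition hits (n : nat) (q : R) (xi eta : Sigma) (s : G) :=
  forall h : Sigma -> G -> R, (forall xi g, 0 <= h xi g) ->
  forall g, q * h eta (s * g)%g <= iter n lazy h xi g.

Lemma lazy_ge0 h : (forall xi g, 0 <= h xi g) -> forall xi g, 0 <= lazy h xi g.
Proof.
move=> h0 xi g; apply: divr_ge0 => //; apply: addr_ge0 => //; apply: sumr_ge0 => a _.
by rewrite mulr_ge0 ?branch_weight_ge0.
Qed.

Lemma hits_stay n q xi eta s c : 0 <= q -> c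
  <= 1/2 -> hits n q xi eta s -> hits n.+1 (q * c) xi eta s.
Proof.
move=> q0 c0 H h h0 g; rewrite iterSr; apply: le_trans (H _ (lazy_ge0 h0) g).
rewrite -mulrA ler_wpM2l// /lazy_operator.
have : 0 <= transfer h eta (s * g)%g.
  by apply: sumr_ge0 => a _; rewrite mulr_ge0 ?branch_weight_ge0.
by have := h0 eta (s * g)%g; nra.
Qed.

Lemma hits_step n q xi eta s c a : 0 <= q -> 0 <= c -> c <= weight a eta / 2 ->
  hits n q xi eta s -> hits n.+1 (q * c) xi (prep a eta) (gamma a * s)%g.
Proof.
move=> q0 c0 ce H h h0 g; rewrite iterSr; apply: le_trans (H _ (lazy_ge0 h0) g).
rewrite -mulrA ler_wpM2l// /lazy_operator.
have : weight a eta * h (prep a eta) (gamma a * (s * g))%g <= transfer h eta (s * g)%g.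
  rewrite /transfer_operator (bigD1 a)//= lerDl sumr_ge0// => b _.
  by rewrite mulr_ge0 ?branch_weight_ge0.
rewrite -mulgA; have := h0 eta (s * g)%g; have := h0 (prep a eta) (gamma a * (s * g))%g.
by nra.
Qed.

Lemma hits_stays m n q xi eta s c : 0 <= q -> 0 <= c -> c <= 1/2 ->
  hits n q xi eta s -> hits (m + n) (q * c ^+ m) xi eta s.
Proof.
move=> q0 c0 c1 H; elim: m => [|m IH]; first by rewrite expr0 mulr1.
by rewrite addSn exprSr mulrA; apply: hits_stay => //; rewrite mulr_ge0 ?exprn_ge0.
Qed.

Lemma hits_word (c : R) n (K : nat) (xi zeta : Sigma) : 0 <= c ->
  (forall a eta, allowed a eta -> c <= weight a eta / 2) -> (memory X <= K)%N ->
  agree K xi (iter n (@sft_shift A X) zeta) ->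
  exists eta, agree (n + K) eta zeta /\ hits n (c ^+ n) xi eta (cocycle gamma n zeta).
Proof.
move=> c0 cw mK; elim: n zeta => [|n IH] zeta ag.
  exists xi; split=> // h h0 g.
  by rewrite expr0 /cocycle big_ord0 mul1g mul1r.
have [|eta [ag' H]] := IH (sft_shift zeta); first by rewrite -iterSr.
have al : allowed (letter zeta 0) eta.
  apply: (@allowed_agree _ _ _ (sft_shift zeta)); last exact: allowed_shift.
  by apply/agree_sym/(agree_le _ ag'); rewrite (leq_trans mK)// leq_addl.
exists (prep (letter zeta 0) eta); split.
  by rewrite -[zeta in agree _ _ zeta]prep_shift addSn; apply: agree_prep => //;
    exact: allowed_shift.
have -> : cocycle gamma n.+1 zeta = (gamma (letter zeta 0) * cocycle gamma n (sft_shift zeta))%g.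
  rewrite /cocycle big_ord_recl; congr (_ * _)%g.
  by apply: eq_bigr => i _; rewrite lift0 iterSr.
by rewrite exprSr; apply: hits_step => //; [exact: exprn_ge0|exact: cw].
Qed.

End Hits.

Section Cylinders.
Variables (A : finType) (X : sft A).
Local Notation Sigma := (sft_space X).

Lemma open_letter n a : open [set xi : Sigma | letter xi n = a].
Proof.
have /continuousP H : continuous (\val : Sigma -> full_shift A) by exact: initial_continuous.
have /continuousP H' : continuous (proj n : full_shift A -> discrete_topology A) by exact:
  proj_continuous.
have := H _ (H' [set a] (discrete_open _)).
by congr open.
Qed.

Lemma open_agree K (zeta : Sigma) : open [set xi : Sigma | agree K xi zeta].
Proof.
elim: K => [|K IH].
  rewrite (_ : [set _ | _] = setT); first exact: openT.
  by apply/seteqP; split => // xi _ i.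
rewrite (_ : [set _ | _] = [set xi | agree K xi zeta] `&` [set xi | letter xi K = letter zeta K]).
  by apply: openI => //; exact: open_letter.
apply/seteqP; split => xi /=.
  by move=> ag; split; [apply: agree_le ag|exact: ag].
by move=> [ag e] i; rewrite ltnS leq_eqVlt => /predU1P[->//|]; exact: ag.
Qed.

Lemma skew_product_iter (G : groupType) (gamma : A -> G) n (xi : Sigma) g :
  iter n (@skew_product A X G gamma) (xi, g) =
  (iter n (@sft_shift A X) xi, (g * cocycle gamma n xi)%g).
Proof.
elim: n => [|n IH]; first by rewrite /cocycle big_ord0 mulg1.
by rewrite !iterS IH /skew_product/= /cocycle big_ord_recr/= mulgA.
Qed.

(** Transitivity is applied to the cylinder of [xi] at level [s] and the cylinder of [zeta] at level
    [1]. *)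
Lemma transitive_words (G : groupType) (gamma : A -> G) :
  topologically_transitive (@skew_product A X G gamma) ->
  forall K (xi zeta : Sigma) s, exists n eta,
    [/\ agree K eta zeta, agree K xi (iter n (@sft_shift A X) eta) & cocycle gamma n eta = s].
Proof.
move=> tr K xi zeta s.
pose cyl (z : Sigma) (g : G) : set (Sigma * discrete_topology G) :=
  [set p | agree K p.1 z /\ p.2 = g].
have cyl_open z g : open (cyl z g).
  rewrite openE => -[x h] /= [xz hg].
  exists ([set x | agree K x z], [set g]); last by move=> [? ?] [].
  split; first exact: open_nbhs_nbhs (conj (open_agree K z) xz).
  by apply: open_nbhs_nbhs; split => //; exact: discrete_open.
have cyl0 z g : cyl z g !=set0 by exists (z, g).
have [n [[eta g] [/=]]] := tr _ _ (cyl_open xi s) (cyl_open zeta 1%g) (cyl0 _ _) (cyl0 _ _).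
rewrite skew_product_iter => -[/= ag ge] [/= ag' g1].
by exists n, eta; split=> //; [exact: agree_sym|rewrite -ge g1 mul1g].
Qed.

End Cylinders.

Section UniformHits.
Variables (A : finType) (X : sft A) (R : realType) (phi : sft_space X -> R).
Variables (G : groupType) (gamma : A -> G).
Local Notation Sigma := (sft_space X).
Local Notation weight := (branch_weight phi).
Local Notation lazy := (lazy_operator phi gamma).

(** Any two points agree on zero letters, so [phi] oscillates by at most [C]. *)
Lemma weight_lower_bound (C r : R) :
  (forall k xi eta, agree k xi eta -> `|phi xi - phi eta| <= C * r ^+ k) ->
  exists c : R, [/\ 0 < c, c <= 1/2 & forall a eta, allowed a eta -> c <= weight a eta / 2].
Proof.
move=> H; pose z : Sigma := sft_point X; pose p := expR (phi z - C).
have p0 : 0 < p by exact: expR_gt0.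
exists (Num.min 1 p / 2); split.
- by rewrite divr_gt0// lt_min ltr01.
- by rewrite ler_pM2r ?invr_gt0// ge_min lexx.
move=> a eta al; rewrite ler_pM2r ?invr_gt0// /branch_weight al ge_min; apply/orP; right.
rewrite ler_expR; have /(H 0%N) : agree 0 (prep a eta) z by [].
by rewrite expr0 mulr1 ler_norml => /andP[h _]; lra.
Qed.

(** The word to prepend depends on [xi] only through its first [K] letters, so finitely many words
    suffice. Laziness pads them all to the same length [N]. *)
Lemma uniform_hits (C r : R) (k0 : nat) (zeta : Sigma) (S : seq G) :
  (forall k xi eta, agree k xi eta -> `|phi xi - phi eta| <= C * r ^+ k) ->
  topologically_transitive (@skew_product A X G gamma) ->
  exists (N : nat) (q : R), [/\ 0 < q, q <= 1 &
    forall xi s, s \in S -> exists eta, agree k0 eta zeta /\ hits phi gamma N q xi eta s].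
Proof.
move=> hphi tr; have [c [c0 c1 cw]] := weight_lower_bound hphi.
pose K := maxn k0 (memory X).
have H (t : K.-tuple A) (s : G) : exists n, forall xi : Sigma, (forall i : 'I_K,
  letter xi i = tnth t i) ->
    exists eta, agree k0 eta zeta /\ hits phi gamma n (c ^+ n) xi eta s.
  have [[x xt]|no] := pselect (exists x : Sigma, forall i : 'I_K, letter x i = tnth t i);
    last first.
    by exists 0%N => xi xit; exfalso; apply: no; exists xi.
  have [n [eta [ag1 ag2 coc]]] := transitive_words tr K x zeta s.
  exists n => xi xit.
  have ag3 : agree K xi (iter n (@sft_shift A X) eta).
    move=> i iK; rewrite -ag2//.
    by rewrite (xit (Ordinal iK)) (xt (Ordinal iK)).
  have [eta' [ag4 h]] := hits_word gamma (ltW c0) cw (leq_maxr k0 _) ag3.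
  exists eta'; rewrite -coc; split=> // i ik.
  rewrite ag4 ?ag1// ?(leq_trans ik) ?leq_maxl//.
  by rewrite (leq_trans _ (leq_addl _ _))// leq_maxl.
have [nf Hnf] := choice (fun ts : K.-tuple A * G => H ts.1 ts.2).
pose N := \max_(t : K.-tuple A) \max_(s <- S) nf (t, s).
exists N, (c ^+ N); split.
- exact: exprn_gt0.
- by rewrite exprn_ile1 ?ltW//; lra.
move=> xi s sS; pose t := [tuple letter xi i | i < K].
have [eta [ag h]] := Hnf (t, s) xi (fun i => esym (tnth_mktuple _ i)).
exists eta; split=> //.
have nN : (nf (t, s) <= N)%N.
  apply: (@leq_trans (\max_(s <- S) nf (t, s))).
    exact: (leq_bigmax_seq (F := fun s => nf (t, s))).
  exact: (leq_bigmax (F := fun t => \max_(s <- S) nf (t, s))).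
rewrite -(subnK nN) exprD mulrC; apply: hits_stays => //; [exact/exprn_ge0/ltW|exact: ltW].
Qed.

End UniformHits.

(** * Contraction of the lazy operator *)

Lemma expr_small (R : realType) (r e : R) (m : nat) : 0 < r -> r < 1 -> 0 < e ->
  exists2 k, (m <= k)%N & r ^+ k <= e.
Proof.
move=> r0 r1 e0; have : r ^+ n @[n --> \oo] --> (0 : R).
  by apply: cvg_expr; rewrite ger0_norm// ltW.
move/cvgrPdist_le/(_ e e0) => [N _ HN].
exists (maxn m N); first exact: leq_maxl.
have := HN (maxn m N) (leq_maxr _ _).
by rewrite /= sub0r normrN ger0_norm// exprn_ge0// ltW.
Qed.

Section LazyContraction.
Variables (A : finType) (X : sft A) (R : realType) (phi : sft_space X -> R).
Variables (G : groupType) (gamma : A -> G).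
Hypothesis normphi : normalized phi.
Local Notation Sigma := (sft_space X).
Local Notation weight := (branch_weight phi).
Local Notation lazy := (lazy_operator phi gamma).

(** The squared [l^2(G)] norm, uniformly over [Sigma], expressed by finite partial sums. *)
Definition l2_bounded (c : R) (h : Sigma -> G -> R) :=
  forall xi (s : seq G), uniq s -> \sum_(g <- s) h xi g ^+ 2 <= c.

Definition supported (t : seq G) (h : Sigma -> G -> R) :=
  forall xi g, g \notin t -> h xi g = 0.

Lemma supported_lazy t h : supported t h -> exists t', supported t' (lazy h).
Proof.
move=> ht; exists (t ++ [seq ((gamma a)^-1 * g)%g | a <- enum A, g <- t]) => xi g.
rewrite mem_cat negb_or => /andP[gt /allpairsPdep gt'].
rewrite /lazy_operator (ht _ _ gt) add0r /transfer_operator big1 ?mul0r// => a _.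
rewrite ht ?mulr0//; apply/negP => at'; apply: gt'.
by exists a, (gamma a * g)%g; rewrite mem_enum mulKg.
Qed.

Lemma supported_iter_lazy n t h : supported t h -> exists t', supported t' (iter n lazy h).
Proof.
elim: n => [|n IH] ht; first by exists t.
by have [t' ht'] := IH ht; rewrite iterS; exact: supported_lazy ht'.
Qed.

(* [b] is carried along as a function on [Sigma * G] not depending on the group element. *)
Lemma sum_lazy (k : Sigma -> G -> R) (b : Sigma -> R) n :
  (forall xi (s : seq G), uniq s -> \sum_(g <- s) k xi g <= b xi) ->
  forall xi (s : seq G) g0, uniq s ->
    \sum_(g <- s) iter n lazy k xi g <= iter n lazy (fun xi _ => b xi) xi g0.
Proof.
move=> kb; elim: n => [|n IH] xi s g0 us; first exact: kb.
rewrite !iterS /lazy_operator -mulr_suml ler_pM2r ?invr_gt0// big_split/= lerD//; first exact: IH.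
rewrite /transfer_operator exchange_big/=; apply: ler_sum => a _.
rewrite -mulr_sumr ler_wpM2l ?branch_weight_ge0//.
rewrite -(big_map (fun g => gamma a * g)%g predT (iter n lazy k (prep a xi))).
by apply: IH; rewrite map_inj_uniq//; exact: mulgI.
Qed.

Lemma lazy_variance (h : Sigma -> G -> R) N xi g (z := iter N lazy h xi g) :
  iter N lazy (fun xi g => (h xi g - z) ^+ 2) xi g =
  iter N lazy (fun xi g => h xi g ^+ 2) xi g - z ^+ 2.
Proof.
have -> : (fun xi g => (h xi g - z) ^+ 2) =
    (fun xi g => 1 * h xi g ^+ 2 + (fun xi g => (- 2 * z) * h xi g + (fun _ _ => z ^+ 2) xi
      g) xi g).
  by apply/funext => xi'; apply/funext => g'; ring.
by rewrite (iter_lazy_lin phi gamma N) (iter_lazy_lin phi gamma N) iter_lazy_const// -/z; ring.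
Qed.

Lemma ratio_close (x y e : R) : 0 <= x -> 0 <= y -> 0 <= e ->
  x <= (1 + e) * y -> y <= (1 + e) * x -> (x - y) ^+ 2 <= e ^+ 2 * y ^+ 2.
Proof.
move=> x0 y0 e0 h1 h2; rewrite -exprMn -subr_ge0 subr_sqr mulr_ge0//.
  by nra.
by nra.
Qed.

(* With [z = T^N h xi g], the variance [T^N ((h - z)^2) = T^N (h^2) - z^2] is bounded below by the
   contributions of two words reaching [1] and [a] in the same long cylinder, where [h] is nearly
   independent of the point of the cylinder. *)
Lemma lazy_contraction (S : seq G) (kappa C r D : R) :
  0 < kappa ->
  (forall (f : G -> R) (t : seq G), uniq t -> (forall g, g \notin t -> f g = 0) ->
    exists2 a, a \in S & exists2 s : seq G, uniq s &
    kappa * (\sum_(g <- t) f g ^+ 2) <= \sum_(g <- s) (f (a * g)%g - f g) ^+ 2) ->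
  0 < r -> r < 1 -> 0 <= D ->
  (forall k xi eta, agree k xi eta -> `|phi xi - phi eta| <= C * r ^+ k) ->
  topologically_transitive (@skew_product A X G gamma) ->
  exists (N : nat) (rho : R), [/\ 0 <= rho, rho < 1 &
    forall h t c, cone D r h -> supported t h -> l2_bounded c h ->
      l2_bounded (rho * c) (iter N lazy h)].
Proof.
move=> kappa0 nonam r0 r1 D0 hphi tr.
(* Replacing [h eta2] by [h eta1] will cost [e^2 <= kappa / 4] out of [kappa / 2]; the third bound
   yields a depth [k0] at which distortion is at most [1 + e]. *)
have [e [e0 e1 eD]] : exists e : R, [/\ 0 < e, e ^+ 2 <= kappa / 4 & 0 < ln (1 + e) / (D + 1)].
  exists (Num.min 1 (kappa / 4)).
  have m0 : 0 < Num.min 1 (kappa / 4) by rewrite lt_min ltr01 divr_gt0.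
  have m1 : Num.min 1 (kappa / 4) <= 1 by rewrite ge_min lexx.
  have m2 : Num.min 1 (kappa / 4) <= kappa / 4 by rewrite ge_min lexx orbT.
  split=> //; first by rewrite expr2; nra.
  by rewrite divr_gt0 ?ln_gt0 ?ltrDl// ltr_wpDl.
have [k0 mk0 k0e] := expr_small (memory X) r0 r1 eD.
have ke : expR (D * r ^+ k0) <= 1 + e.
  rewrite -[leRHS]lnK ?posrE ?addr_gt0// ler_expR.
  move: k0e; rewrite ler_pdivlMr ?ltr_wpDl//; apply: le_trans.
  by rewrite mulrC ler_wpM2l ?lerDl ?exprn_ge0// ltW.
have [N [q [q0 q1 Hq]]] := uniform_hits k0 (sft_point X) (1%g :: S) hphi tr.
pose kap := Num.min 1 (kappa / 16).
have kap0 : 0 < kap by rewrite lt_min ltr01 divr_gt0.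
have kap1 : kap <= 1 by rewrite ge_min lexx.
have kap2 : kap <= kappa / 16 by rewrite ge_min lexx orbT.
exists N, (1 - q * kap); split; [by nra|by nra|].
move=> h t0 c [h0 hD] ht0 hc xi s us.
pose t := undup t0; have ut : uniq t by exact: undup_uniq.
have ht : supported t h by move=> eta g; rewrite mem_undup; exact: ht0.
have [eta1 [ag1 hit1]] := Hq xi 1%g (mem_head _ _).
pose f := h eta1.
have [a aS [s1 us1 Hs1]] := nonam f t ut (ht eta1).
have [eta2 [ag2 hit2]] := Hq xi a (@mem_behead _ (1%g :: S) a aS).
(* The set of summation is enlarged so that the defect of invariance given by [nonam] becomes
   visible. *)
pose s' := undup (s ++ s1); have us' : uniq s' by exact: undup_uniq.
apply: (@le_trans _ _ (\sum_(g <- s') iter N lazy h xi g ^+ 2)).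
  by apply: ler_sum_uniq => // [g gs|g]; [rewrite mem_undup mem_cat gs|exact: sqr_ge0].
pose b eta := \sum_(g <- t) h eta g ^+ 2.
have hb eta (u : seq G) : uniq u -> \sum_(g <- u) h eta g ^+ 2 <= b eta.
  move=> uu; pose v := undup (u ++ t).
  apply: (@le_trans _ _ (\sum_(g <- v) h eta g ^+ 2)).
    apply: ler_sum_uniq => // [|g gs|g]; first exact: undup_uniq.
      by rewrite mem_undup mem_cat gs.
    exact: sqr_ge0.
  rewrite (sum_support predT (undup_uniq _) ut)// => [g gt|g gt].
    by rewrite mem_undup mem_cat gt orbT.
  by rewrite ht// expr0n.
have bc eta : b eta <= c by exact: hc.
(* First gain, useful when the mass [b eta1] falls short of [c]: the walk charges [eta1] with mass
   [q]. *)
have H1 : \sum_(g <- s') iter N lazy (fun xi g => h xi g ^+ 2) xi g <= c - q * (c - b eta1).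
  apply: (le_trans (sum_lazy N hb xi 1%g us')).
  have p0 eta (g : G) : 0 <= c - b eta by rewrite subr_ge0.
  have := hit1 (fun eta _ => c - b eta) p0 1%g.
  have -> : (fun eta (_ : G) => c - b eta) = (fun eta g => -1 * (fun eta (_ : G) => b eta)
    eta g + (fun _ _ => c) eta g).
    by apply/funext => eta; apply/funext => g; rewrite mulN1r addrC.
  by rewrite (iter_lazy_lin phi gamma N) iter_lazy_const//; lra.
(* Second gain, from the variance: [(x - z)^2 + (y - z)^2 >= (x - y)^2 / 2], and each square on the
   left is charged with mass [q]. *)
have H2 g : iter N lazy (fun xi g => h xi g ^+ 2) xi g - iter N lazy h xi g ^+ 2 >=
    q / 4 * (f g - h eta2 (a * g)%g) ^+ 2.
  rewrite -lazy_variance; set z := iter N lazy h xi g.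
  have p0 eta g' : 0 <= (h eta g' - z) ^+ 2 by exact: sqr_ge0.
  have := hit1 _ p0 g; have := hit2 _ p0 g; rewrite mul1g -/(f g).
  move: (iter _ _ _ _ _) (f g) (h eta2 _) => w x y.
  have := sqr_ge0 ((x - z) + (y - z)); nra.
have H3 : \sum_(g <- s') (f g - h eta2 (a * g)%g) ^+ 2 >= kappa / 4 * b eta1.
  have close x : (f x - h eta2 x) ^+ 2 <= e ^+ 2 * f x ^+ 2.
    have ag12 : agree k0 eta1 eta2 by move=> i ik; rewrite ag1// ag2.
    rewrite -(sqrrN (f x - _)) opprB; apply: ratio_close; [exact: h0|exact: h0|exact: ltW| |].
      apply: le_trans (hD k0 _ _ x mk0 (agree_sym ag12)) _.
      by rewrite ler_wpM2r.
    apply: le_trans (hD k0 _ _ x mk0 ag12) _.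
    by rewrite ler_wpM2r.
  have B1 : kappa * b eta1 <= \sum_(g <- s') (f (a * g)%g - f g) ^+ 2.
    apply: le_trans Hs1 _; apply: ler_sum_uniq => // [g gs|g]; last exact: sqr_ge0.
    by rewrite mem_undup mem_cat gs orbT.
  have B2 : \sum_(g <- s') f (a * g)%g ^+ 2 <= b eta1.
    rewrite -(big_map (fun g => a * g)%g predT (fun g => f g ^+ 2)); apply: hb.
    by rewrite map_inj_uniq//; exact: mulgI.
  have B3 : \sum_(g <- s') (1/2 * (f (a * g)%g - f g) ^+ 2 - e ^+ 2 * f (a * g)%g ^+ 2) <=
      \sum_(g <- s') (f g - h eta2 (a * g)%g) ^+ 2.
    apply: ler_sum => g _; have := close (a * g)%g.
    move: (f (a * g)%g) (f g) (h eta2 _) => x y w.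
    have := sqr_ge0 ((x - w) + (y - w)); move: (e ^+ 2 * x ^+ 2) => E.
    by move=> h1 h2; nra.
  rewrite sumrB -!mulr_sumr in B3.
  have b0 : 0 <= b eta1 by apply: sumr_ge0 => g _; exact: sqr_ge0.
  have := sqr_ge0 e; move: e1 B1 B2 B3 b0.
  move: (e ^+ 2) (\sum_(g <- s') _) (\sum_(g <- s') _) (\sum_(g <- s') _) (b eta1) => E x y z w.
  by move=> *; nra.
have H4 : \sum_(g <- s') iter N lazy h xi g ^+ 2 <=
   \sum_(g <- s') iter N lazy (fun xi g => h xi g ^+ 2) xi g - q / 4 * \sum_(g <- s') (f g -
     h eta2 (a * g)%g) ^+ 2.
  rewrite mulr_sumr -sumrB; apply: ler_sum => g _; have := H2 g; lra.
(* The two gains [q (c - b)] and [q kappa / 16 b], with [b = b eta1], add up to at least [q kap c]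
   whatever the value of [b]. *)
apply: le_trans H4 _.
have b0 : 0 <= b eta1 by apply: sumr_ge0 => g _; exact: sqr_ge0.
have k1 : 0 <= q * (1 - kap) * (c - b eta1).
  by rewrite mulr_ge0 ?subr_ge0// mulr_ge0 ?subr_ge0// ltW.
have k2 : 0 <= q * (kappa / 16 - kap) * b eta1.
  by rewrite mulr_ge0// mulr_ge0 ?subr_ge0// ltW.
have k3 : q / 4 * (kappa / 4 * b eta1) <= q / 4 * \sum_(g <- s') (f g - h eta2 (a * g)%g) ^+ 2.
  by rewrite ler_wpM2l// divr_ge0// ltW.
move: H1 k1 k2 k3; move: (b eta1) (\sum_(g <- s') _) (\sum_(g <- s') _) => u v w.
by move=> *; lra.
Qed.

End LazyContraction.

(** * Positive drift *)

Section Density.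
Context d (T : measurableType d) (R : realType).
Variables (mu nu : {measure set T -> \bar R}) (f : T -> R).
Hypotheses (mf : measurable_fun setT f) (f0 : forall x, 0 <= f x).
Hypothesis nuE : forall B : set T, measurable B -> nu B = (\int[mu]_(x in B) (f x)%:E)%E.

Import HBNNSimple.

Lemma integral_density_nnsfun (h : {nnsfun T >-> R}) :
  (\int[nu]_x (h x)%:E = \int[mu]_x (h x * f x)%:E)%E.
Proof.
rewrite integral_nnsfun//= patch_setT sintegralE.
transitivity (\int[mu]_x \sum_(y \in range h) (y * \1_(h @^-1` [set y]) x * f x)%:E)%E.
  rewrite ge0_integral_fsum//=; last 2 first.
  - by move=> y; apply/measurable_EFinP; do 2?apply: measurable_funM.
  - move=> y x _; rewrite lee_fin mulr_ge0//.
    by have := nnfun_muleindic_ge0 h y x; rewrite lee_fin.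
  apply: eq_fsbigr => y /set_mem[z _ <-].
  rewrite nuE// integral_mkcond.
  under [RHS]eq_integral do rewrite -mulrA EFinM.
  rewrite ge0_integralZl//=.
  - congr (_ * _)%E; apply: eq_integral => x _; rewrite patchE indicE.
    by case: ifPn; rewrite ?mul1r ?mul0r.
  - by apply/measurable_EFinP; apply: measurable_funM.
  - by move=> x _; rewrite lee_fin mulr_ge0.
  - by rewrite lee_fin.
apply: eq_integral => x _; rewrite fsumEFin//; congr (_%:E).
rewrite [in RHS](fimfunE h x) !fsbig_finite//= mulr_suml.
by apply: eq_bigr => y _.
Qed.

Lemma ge0_integral_density (g : T -> R) : measurable_fun setT g -> (forall x, 0 <= g x) ->
  (\int[nu]_x (g x)%:E = \int[mu]_x (g x * f x)%:E)%E.
Proof.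
move=> mg g0; have mg' : measurable_fun setT (EFin \o g) by exact/measurable_EFinP.
pose h := nnsfun_approx measurableT mg'.
have hg x : (h n x)%:E @[n --> \oo] --> (g x)%:E.
  by apply: (cvg_nnsfun_approx measurableT mg') => // y _; rewrite lee_fin.
have hmono x : {homo (fun n => h n x) : n m / (n <= m)%N >-> n <= m}.
  by move=> n m nm; exact/lefP/nd_nnsfun_approx.
transitivity (limn (fun n => \int[nu]_x (h n x)%:E)%E).
  rewrite -monotone_convergence//=.
  - by apply: eq_integral => x _; apply/esym/cvg_lim => //; exact: hg.
  - by move=> n; apply/measurable_EFinP.
  - by move=> n x _; rewrite lee_fin.
  - by move=> x _ n m nm; rewrite lee_fin hmono.
transitivity (limn (fun n => \int[mu]_x (h n x * f x)%:E)%E).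
  by congr (limn _); apply/funext => n; exact: integral_density_nnsfun.
rewrite -monotone_convergence//=.
- apply: eq_integral => x _; apply/cvg_lim => //.
  by under eq_fun do rewrite EFinM; rewrite EFinM; apply: cvgeZr => //; exact: hg.
- by move=> n; apply/measurable_EFinP/measurable_funM.
- by move=> n x _; rewrite lee_fin mulr_ge0.
- by move=> x _ n m nm; rewrite lee_fin ler_wpM2r// hmono.
Qed.

End Density.

(** * Continuity and measurability on the subshift *)

Section Borel.
Variables (A : finType) (X : sft A) (R : realType).
Local Notation Sigma := (sft_space X).

Lemma near_agree k (xi : Sigma) : \forall eta \near xi, agree k eta xi.
Proof. by apply: open_nbhs_nbhs; split; [exact: open_agree|]. Qed.

Lemma continuous_full_shift (T : topologicalType) (f : T -> full_shift A) :
  (forall n, continuous (fun t => f t n : discrete_topology A)) -> continuous f.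
Proof.
move=> H t; have FF : Filter (f x @[x --> t]) by apply: fmap_filter; exact: nbhs_filter.
apply/(cvg_sup _ _ FF) => n.
exact: (@continuous_comp_initial (full_shift A) T (discrete_topology A) (fun g => g n) f (H n)).
Qed.

Lemma letter_continuous (f : Sigma -> Sigma) :
  (forall n xi, \forall eta \near xi, letter (f eta) n = letter (f xi) n) -> continuous f.
Proof.
move=> H.
apply: (@continuous_comp_initial Sigma Sigma (full_shift A) \val f).
apply: continuous_full_shift => n xi; apply: cvg_near_cst; [exact: nbhs_filter|exact: H].
Qed.

Lemma shift_continuous : continuous (@sft_shift A X).
Proof.
apply: letter_continuous => n xi.
near=> eta; rewrite !letter_shift.
have ag : agree n.+2 eta xi by near: eta; exact: near_agree.
exact: ag.
Unshelve. all: by end_near. Qed.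

Lemma near_allowed a (xi : Sigma) : \forall eta \near xi, allowed a eta = allowed a xi.
Proof.
near=> eta.
have ag : agree (memory X) eta xi by near: eta; exact: near_agree.
by apply/idP/idP; apply: allowed_agree => //; exact: agree_sym.
Unshelve. all: by end_near. Qed.

Lemma letter_prep_agree a n (xi eta : Sigma) : agree n.+1 eta xi ->
  allowed a eta = allowed a xi -> letter (prep a eta) n = letter (prep a xi) n.
Proof.
move=> ag al; have [h|h] := boolP (allowed a xi).
  rewrite h in al; case: n ag => [|n] ag; first by rewrite !letter_prep0.
  by rewrite !letter_prepS// ag.
have h' : ~~ allowed a eta by rewrite al.
rewrite /prep; case: pselect => [h1|_]; first by rewrite h1 in h'.
by case: pselect => [h1|_]; [rewrite h1 in h|exact: ag].
Qed.

Lemma prep_continuous a : continuous (@prep A X a).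
Proof.
apply: letter_continuous => n xi; near=> eta; apply: letter_prep_agree.
  by near: eta; exact: near_agree.
by near: eta; exact: near_allowed.
Unshelve. all: by end_near. Qed.

Lemma hoelder_is_continuous (phi : Sigma -> R) (C r : R) : 0 < r -> r < 1 -> 0 <= C ->
  (forall k xi eta, agree k xi eta -> `|phi xi - phi eta| <= C * r ^+ k) ->
  continuous phi.
Proof.
move=> r0 r1 C0 H xi; have FF := @nbhs_filter Sigma xi.
apply/cvgrPdist_le => e e0.
have [k _ ke] := expr_small 0 r0 r1 (divr_gt0 e0 (ltr_wpDl C0 ltr01)).
near=> eta; have ag : agree k eta xi by near: eta; exact: near_agree.
apply: le_trans (H k xi eta (agree_sym ag)) _.
apply: (@le_trans _ _ ((C + 1) * r ^+ k)).
  by rewrite ler_wpM2r ?lerDl// exprn_ge0// ltW.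
by rewrite mulrC -ler_pdivlMr// ltr_wpDl.
Unshelve. all: by end_near. Qed.

Lemma open_measurable_sft (U : set (borel_sft X)) : @open Sigma U -> measurable U.
Proof. by move=> oU; exact: sub_sigma_algebra. Qed.

Lemma continuous_measurable_sft (f : Sigma -> R) : continuous f ->
  measurable_fun [set: borel_sft X] (f : borel_sft X -> R).
Proof.
move=> /continuousP cf; apply: (measurability _ (@RGenOpens.measurableE R)).
move=> _ [_ [x [y ->]] <-]; rewrite setTI; apply: open_measurable_sft.
by apply: cf; exact: interval_open.
Qed.

Lemma continuous_measurable_sft2 (f : Sigma -> Sigma) : continuous f ->
  measurable_fun [set: borel_sft X] (f : borel_sft X -> borel_sft X).
Proof.
move=> /continuousP cf; apply: (@measurability _ _ (borel_sft X) (borel_sft X) setT f (@open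
  Sigma)) => //.
by move=> _ [U oU <-]; rewrite setTI; apply: open_measurable_sft; exact: cf.
Qed.

End Borel.

Section TransferIntegral.
Variables (A : finType) (X : sft A) (R : realType) (phi : sft_space X -> R).
Variable nu : probability (borel_sft X) R.
Hypothesis cphi : continuous phi.
Hypothesis jac : has_jacobian nu phi.
Local Notation Sigma := (sft_space X).
Local Notation weight := (branch_weight phi).

Lemma weight_continuous a : continuous (weight a).
Proof.
move=> xi; have FF := @nbhs_filter Sigma xi.
have [h|h] := boolP (allowed a xi).
  have H : {near xi, (fun eta => expR (phi (prep a eta))) =1 weight a}.
    near=> eta; rewrite /branch_weight.
    have -> : allowed a eta = allowed a xi by near: eta; exact: near_allowed.
    by rewrite h.
  apply: cvg_trans; first exact: (near_eq_cvg H).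
  rewrite /branch_weight h.
  apply: (@continuous_comp Sigma Sigma R (prep a) (fun x => expR (phi x)));
    first exact: prep_continuous.
  apply: (@continuous_comp Sigma R R phi expR); first exact: cphi.
  exact: continuous_expR.
have e0 : weight a xi = 0 by rewrite /branch_weight (negbTE h).
rewrite /continuous_at e0; apply: cvg_near_cst; near=> eta; rewrite /branch_weight.
have -> : allowed a eta = allowed a xi by near: eta; exact: near_allowed.
by rewrite (negbTE h).
Unshelve. all: by end_near. Qed.

Let mweight a : measurable_fun setT (weight a : borel_sft X -> R).
Proof. apply: continuous_measurable_sft; exact: weight_continuous. Qed.

Let mprep (k : Sigma -> R) a : measurable_fun setT (k : borel_sft X -> R) ->
  measurable_fun setT ((fun xi => k (prep a xi)) : borel_sft X -> R).
Proof.
move=> mk; apply: (@measurableT_comp _ _ _ (borel_sft X) (borel_sft X) R k) => //.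
apply: continuous_measurable_sft2; exact: prep_continuous.
Qed.

Lemma measurable_first a : measurable ([set xi | letter xi 0 = a] : set (borel_sft X)).
Proof. by apply: open_measurable_sft; exact: open_letter. Qed.

Lemma shift_inj_first a : {in [set xi : Sigma | letter xi 0 = a] &, injective (@sft_shift A X)}.
Proof.
move=> xi eta /set_mem/= h1 /set_mem/= h2 e; apply: letter_inj => -[|n]; first by rewrite h1 h2.
by rewrite -!letter_shift e.
Qed.

(* On the cylinder [letter xi 0 = a] the shift is injective and carries [nu_shift] to [nu]. *)
Lemma transfer_integral (k : Sigma -> R) :
  measurable_fun setT (k : borel_sft X -> R) -> (forall xi, 0 <= k xi) ->
  (\int[nu]_xi (\sum_a weight a xi * k (prep a xi))%:E = \int[nu]_xi (k xi)%:E)%E.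
Proof.
move=> mk k0; have [mu [muE nuE]] := jac.
have mexp : measurable_fun setT ((fun xi => expR (phi xi)) : borel_sft X -> R).
  by apply/measurableT_comp => //; exact: continuous_measurable_sft.
rewrite (@ge0_integral_density _ (borel_sft X) R mu nu (fun xi => expR (phi xi)) mexp _ nuE k
  mk k0); last first.
  by move=> xi; exact: expR_ge0.
have w0 a xi : 0 <= weight a xi * k (prep a xi) by rewrite mulr_ge0 ?branch_weight_ge0.
have mw a : measurable_fun setT ((fun xi => weight a xi * k (prep a xi)) : borel_sft X -> R).
  by apply: measurable_funM => //; exact: mprep.
transitivity (\int[nu]_xi (\sum_a (weight a xi * k (prep a xi))%:E))%E.
  by apply: eq_integral => xi _; rewrite sumEFin.
rewrite ge0_integral_sum//=; last 2 first.
- by move=> a; exact/measurable_EFinP.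
- by move=> a xi _; rewrite lee_fin.
pose D a : set (borel_sft X) := [set xi | letter xi 0 = a].
have mD a : measurable (D a) by exact: measurable_first.
transitivity (\sum_a \int[mu]_xi (k xi * expR (phi xi) * \1_(D a) xi)%:E)%E; last first.
  rewrite -ge0_integral_sum//=; last 2 first.
  - move=> a; apply/measurable_EFinP; apply: measurable_funM => //; first exact: measurable_funM.
  - by move=> a xi _; rewrite lee_fin !mulr_ge0// expR_ge0.
  apply: eq_integral => xi _; rewrite sumEFin -mulr_sumr (bigD1 (letter xi 0))//= indicE.
  rewrite mem_set//= big1 ?addr0 ?mulr1// => a an.
  by rewrite indicE memNset//= => e; rewrite -e eqxx in an.
apply: eq_bigr => a _.
pose f xi := weight a xi * k (prep a xi).
have mshift : measurable_fun setT (@sft_shift A X : borel_sft X -> borel_sft X).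
  apply: continuous_measurable_sft2; exact: shift_continuous.
pose T : set (borel_sft X) := [set xi | allowed a xi].
have mT : measurable T.
  apply: open_measurable_sft; rewrite openE => xi /= h.
  by have := near_allowed a xi; apply: filterS => eta; rewrite h.
pose mr := mrestr mu (mD a).
have fT xi : ~ T xi -> f xi = 0.
  by rewrite /T /f /branch_weight /= => /negP/negbTE ->; rewrite mul0r.
transitivity (\int[nu]_(xi in T) (f xi)%:E)%E.
  rewrite [RHS]integral_mkcond; apply: eq_integral => xi _; rewrite patchE.
  by case: ifPn => // /negP h; rewrite -/(f xi) fT// => /mem_set.
pose m := pushforward mr (@sft_shift A X : borel_sft X -> borel_sft X).
transitivity (\int[m]_(xi in T) (f xi)%:E)%E.
  apply: eq_measure_integral => B mB BT.
  have mB' : measurable (@sft_shift A X @^-1` B `&` D a : set (borel_sft X)).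
    by apply: measurableI => //; rewrite -[X in measurable X]setTI; exact: mshift.
  transitivity (mu (@sft_shift A X @^-1` B `&` D a)); last by [].
  rewrite muE//; last first.
    move=> x y /set_mem[_ xD] /set_mem[_ yD]; apply: (@shift_inj_first a); exact: mem_set.
  congr (nu _); apply/seteqP; split=> [xi xiB|_ [xi [xiB _] <-]] //.
  have al := BT _ xiB; exists (prep a xi); last exact: shift_prep.
  by split; rewrite /= ?shift_prep// /D/= letter_prep0.
rewrite ge0_integral_pushforward//=; last 2 first.
- by apply/measurable_EFinP; apply: measurable_funTS; exact: mw.
- by move=> xi _; rewrite lee_fin; exact: w0.
transitivity (\int[mr]_xi (f (sft_shift xi))%:E)%E.
  rewrite [LHS]integral_mkcond; apply: eq_integral => xi _; rewrite patchE.
  by case: ifPn => // /negP h; rewrite fT// => /mem_set.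
have mrE (B : set (borel_sft X)) : measurable B -> mr B = (\int[mu]_(xi in B) (\1_(D a) xi)%:E)%E.
  by move=> mB; rewrite integral_indic// setIC.
rewrite (@ge0_integral_density _ (borel_sft X) R mu mr (\1_(D a)) _ _ mrE)//; last 2 first.
- by apply: (@measurableT_comp _ _ _ (borel_sft X) (borel_sft X) R f) => //; exact: mw.
- by move=> xi; exact: w0.
apply: eq_integral => xi _; rewrite !indicE; case: (boolP (xi \in D a)) => [/set_mem xiD|_];
  last by rewrite !mulr0.
rewrite !mulr1 /f /branch_weight; move: (allowed_shift xi) (prep_shift xi); rewrite xiD => -> ->.
by rewrite mulrC.
Qed.

End TransferIntegral.

Lemma continuous_sum (T : topologicalType) (R : realType) (I : Type) (s : seq I) (f : I -> T
  -> R) :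
  (forall i, continuous (f i)) -> continuous (fun x => \sum_(i <- s) f i x).
Proof.
move=> cf; elim: s => [|i s IH].
  have -> : (fun x => \sum_(i <- [::]) f i x) = (fun _ => 0).
    by apply/funext => x; rewrite big_nil.
  by move=> x; exact: cvg_cst.
have -> : (fun x => \sum_(j <- i :: s) f j x) = (fun x => f i x + \sum_(j <- s) f j x).
  by apply/funext => x; rewrite big_cons.
by move=> x; apply: cvgD; [exact: cf|exact: IH].
Qed.

(** * From inverse branches to forward orbits *)

Section Drift.
Variables (A : finType) (X : sft A) (R : realType) (phi : sft_space X -> R).
Variables (G : groupType) (gamma : A -> G).
Variable nu : probability (borel_sft X) R.
Hypothesis cphi : continuous phi.
Hypothesis normphi : normalized phi.
Hypothesis jac : has_jacobian nu phi.
Local Notation Sigma := (sft_space X).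
Local Notation weight := (branch_weight phi).
Local Notation lazy := (lazy_operator phi gamma).
Local Notation transfer := (transfer_operator phi gamma).

Definition fibre_continuous (h : Sigma -> G -> R) := forall g, continuous (h^~ g).

Lemma fibre_continuous_cst (F : G -> R) : fibre_continuous (fun _ => F).
Proof. by move=> g; exact: (@cst_continuous Sigma R (F g)). Qed.

Lemma transfer_continuous h : fibre_continuous h -> fibre_continuous (transfer h).
Proof.
move=> ch g; apply: continuous_sum => a xi; have FF := @nbhs_filter Sigma xi.
apply: cvgM; first exact: weight_continuous.
apply: (@continuous_comp Sigma Sigma R (prep a) (h^~ (gamma a * g)%g));
  first exact: prep_continuous.
exact: ch.
Qed.

Lemma lazy_continuous h : fibre_continuous h -> fibre_continuous (lazy h).
Proof.
move=> ch g xi; have FF := @nbhs_filter Sigma xi.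
apply: cvgM; last exact: cvg_cst.
by apply: cvgD; [exact: ch|exact: transfer_continuous].
Qed.

Lemma iter_transfer_continuous i h : fibre_continuous h -> fibre_continuous (iter i transfer h).
Proof. by move=> ch; elim: i => // i IH; rewrite iterS; exact: transfer_continuous. Qed.

Lemma iter_lazy_continuous i h : fibre_continuous h -> fibre_continuous (iter i lazy h).
Proof. by move=> ch; elim: i => // i IH; rewrite iterS; exact: lazy_continuous. Qed.

Lemma iter_transfer_ge0 i h : (forall xi g, 0 <= h xi g) -> forall xi g, 0
  <= iter i transfer h xi g.
Proof.
move=> h0; elim: i => // i IH xi g; rewrite iterS; apply: sumr_ge0 => a _.
by rewrite mulr_ge0 ?branch_weight_ge0.
Qed.

Lemma iter_transfer_lin i c h k xi g :
  iter i transfer (fun eta g => c * h eta g + k eta g) xi g =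
  c * iter i transfer h xi g + iter i transfer k xi g.
Proof.
elim: i xi g => // i IH xi g; rewrite !iterS -transfer_lin; congr (transfer_operator _ _ _ xi g).
by apply/funext => eta; apply/funext => g'; rewrite IH.
Qed.

Lemma iter_transfer_lazy i h xi g : iter i transfer (lazy h) xi g =
  2^-1 * iter i transfer h xi g + 2^-1 * iter i.+1 transfer h xi g.
Proof.
have -> : lazy h = (fun eta g => 2^-1 * h eta g + (fun eta g => 2^-1 * transfer h eta g +
  (fun _ _ => 0) eta g) eta g).
  by apply/funext => eta; apply/funext => g'; rewrite /lazy_operator; ring.
rewrite !iter_transfer_lin iterSr.
suff -> : iter i transfer (fun _ _ => 0) xi g = 0 by rewrite addr0.
elim: i xi g => // i IH xi g; rewrite iterS; apply: big1 => a _.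
by rewrite IH mulr0.
Qed.

(** Each step uses the invariance of the integral under the transfer operator. The starting element
    [u] must be allowed to vary with [xi], because the induction replaces it by
    [gamma (letter xi 0) * u (sft_shift xi)]; local constancy keeps the integrand continuous. *)
Lemma integral_iter_transfer (F : G -> R) i (u : Sigma -> G) :
  (forall g, 0 <= F g) -> (forall xi, \forall eta \near xi, u eta = u xi) ->
  (\int[nu]_xi (iter i transfer (fun _ => F) xi (u xi))%:E =
   \int[nu]_xi (F (cocycle gamma i xi * u (iter i (@sft_shift A X) xi))%g)%:E)%E.
Proof.
move=> F0; elim: i u => [|i IH] u cu.
  by apply: eq_integral => xi _; rewrite /cocycle big_ord0 mul1g.
pose u' xi := (gamma (letter xi 0) * u (sft_shift xi))%g.
have cu' xi : \forall eta \near xi, u' eta = u' xi.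
  have Hs : \forall eta \near xi, u (sft_shift eta) = u (sft_shift xi).
    exact: (@shift_continuous A X xi _ (cu (sft_shift xi))).
  near=> eta; rewrite /u'; congr (_ * _)%g.
    by congr gamma; have ag : agree 1 eta xi by [near: eta; exact: near_agree]; exact: ag.
  by near: eta.
pose k xi := iter i transfer (fun _ => F) xi (u' xi).
have ck : continuous k.
  move=> xi; have FF := @nbhs_filter Sigma xi.
  have H : {near xi, (fun eta => iter i transfer (fun _ => F) eta (u' xi)) =1 k}.
    by near=> eta; rewrite /k; congr (iter i transfer _ eta _); apply/esym; near: eta; exact: cu'.
  apply: cvg_trans; first exact: (near_eq_cvg H).
  by apply: iter_transfer_continuous; exact: fibre_continuous_cst.
have k0 xi : 0 <= k xi by apply: iter_transfer_ge0 => ? ?; exact: F0.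
have := transfer_integral cphi jac (continuous_measurable_sft ck) k0.
transitivity (\int[nu]_xi (k xi)%:E)%E; last first.
  rewrite IH//; apply: eq_integral => xi _; congr (F _)%:E.
  by rewrite /u' mulgA /cocycle big_ord_recr/=.
rewrite -(transfer_integral cphi jac (continuous_measurable_sft ck) k0).
apply: eq_integral => xi _; congr (_%:E); rewrite iterS; apply: eq_bigr => a _.
rewrite /branch_weight; case: ifPn => [al|_]; last by rewrite !mul0r.
by rewrite /k /u' letter_prep0// shift_prep.
Unshelve. all: by end_near. Qed.

(** The [m]-th lazy iterate is a binomial average of the transfer iterates of order [j <= m].
    Instead of expanding it, the induction trades one lazy step for the mean of the orders [i] and
    [i + 1]. *)
Lemma integral_iter_lazy_le (F : G -> R) (b : R) m : (forall g, 0 <= F g) ->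
  (forall j, (j <= m)%N -> (\int[nu]_xi (F (cocycle gamma j xi))%:E <= b%:E)%E) ->
  (\int[nu]_xi (iter m lazy (fun _ => F) xi 1%g)%:E <= b%:E)%E.
Proof.
move=> F0 Fb.
have cF : fibre_continuous (fun _ => F) by exact: fibre_continuous_cst.
suff H i n : (i + n <= m)%N ->
    (\int[nu]_xi (iter i transfer (iter n lazy (fun _ => F)) xi 1%g)%:E <= b%:E)%E.
  by have := H 0%N m (leqnn _).
elim: n i => [|n IH] i inm.
  rewrite (@integral_iter_transfer F i (fun _ => 1%g))//; last first.
    by move=> xi; have FF := @nbhs_filter Sigma xi; exact: filterE.
  under eq_integral do rewrite mulg1.
  by apply: Fb; rewrite addn0 in inm.
pose h := iter n lazy (fun _ => F).
have h0 j xi g : 0 <= iter j transfer h xi g.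
  apply: iter_transfer_ge0 => ? ?; apply: (iter_lazy_ge0 gamma normphi) => ? ?; exact: F0.
have mh j : measurable_fun setT ((fun xi => (iter j transfer h xi 1%g)%:E) : borel_sft X ->
  \bar R).
  apply/measurable_EFinP; apply: continuous_measurable_sft.
  by apply: iter_transfer_continuous; exact: iter_lazy_continuous.
rewrite iterS -/h; under eq_integral do rewrite iter_transfer_lazy EFinD !EFinM.
rewrite ge0_integralD//=; last 4 first.
- by move=> xi _; rewrite -EFinM lee_fin mulr_ge0.
- by apply: measurable_funeM; exact: mh.
- by move=> xi _; rewrite -EFinM lee_fin mulr_ge0// (h0 i.+1).
- by apply: measurable_funeM; exact: (mh i.+1).
have Z j : (\int[nu]_xi (2^-1%:E * (iter j transfer h xi 1%g)%:E) =
    2^-1%:E * \int[nu]_xi (iter j transfer h xi 1%g)%:E)%E.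
  by apply: ge0_integralZl => // xi _; rewrite lee_fin.
rewrite (Z i) (Z i.+1).
have -> : b%:E = (2^-1%:E * b%:E + 2^-1%:E * b%:E)%E.
  by rewrite -!EFinM -EFinD; congr (_%:E); field.
apply: leeD; apply: lee_wpmul2l; rewrite ?lee_fin//.
  by apply: IH; rewrite (leq_trans _ inm)// leq_add2l.
by apply: (IH i.+1); rewrite addSnnS.
Qed.

End Drift.

(** * Escape from balls in linear time *)

Section LinearSpeed.
Variables (A : finType) (X : sft A) (R : realType) (phi : sft_space X -> R).
Variables (G : groupType) (gamma : A -> G).
Variable nu : probability (borel_sft X) R.
Hypothesis normphi : normalized phi.
Local Notation Sigma := (sft_space X).
Local Notation lazy := (lazy_operator phi gamma).

(** The indicator of [B] has squared norm at most [size B] in every fibre and lies in the cone; the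
    value at [1] is a single term of the contracted sum. *)
Lemma lazy_decay : hoelder_continuous phi ->
  topologically_transitive (@skew_product A X G gamma) ->
  word_hyperbolic R G -> non_elementary G ->
  exists (N : nat) (rho : R), [/\ 0 < rho, rho < 1 &
    forall k (B : seq G) xi, uniq B ->
      iter (k * N) lazy (fun _ g => (g \in B)%:R) xi 1%g ^+ 2 <= rho ^+ k * (size B)%:R].
Proof.
move=> /hoelder_geometric[C [r [C0 r0 r1 hphi]]] tr hyp ne.
have [S [kappa [kappa0 nonam]]] := hyperbolic_nonamenable hyp ne.
(* The solution of [(C + D) r = D]. *)
pose D := C * r / (1 - r).
have D0 : 0 <= D by rewrite divr_ge0 ?mulr_ge0 ?subr_ge0// ltW.
have CD : (C + D) * r <= D.
  rewrite le_eqVlt; apply/orP; left; apply/eqP; rewrite /D; field.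
  by rewrite gt_eqF// subr_gt0.
have [N [rho [rho0 rho1 H]]] := lazy_contraction normphi kappa0 nonam r0 r1 D0 hphi tr.
(* The contraction rate may be [0]; averaging with [1] makes it positive. *)
exists N, ((1 + rho) / 2); split; [by lra|by lra|].
move=> k B xi uB.
pose h0 : Sigma -> G -> R := fun _ g => (g \in B)%:R.
have coneh j : cone D r (iter j lazy h0).
  elim: j => [|j IH]; first exact: cone_indicator.
  by rewrite iterS; apply: (cone_lazy _ C0 r0 D0 hphi CD).
have bnd : l2_bounded (rho ^+ k * (size B)%:R) (iter (k * N) lazy h0).
  elim: k => [|k IH].
    move=> eta s us; rewrite mul0n expr0 mul1r /= /h0.
    have -> : (size B)%:R = \sum_(g <- B) 1 :> R by rewrite big_const_seq iter_addr_0 count_predT.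
    apply: (@le_trans _ _ (\sum_(g <- s | g \in B) 1)).
      rewrite [leRHS]big_mkcond; apply: ler_sum => g _.
      by case: ifP => _; rewrite ?expr1n ?expr0n.
    rewrite -big_filter; apply: ler_sum_uniq => //; first exact: filter_uniq.
    by move=> g; rewrite mem_filter => /andP[].
  have [t Ht] : exists t, supported t (iter (k * N) lazy h0).
    apply: (@supported_iter_lazy _ _ _ _ _ _ _ B) => eta g gB.
    by rewrite /h0 (negbTE gB).
  by rewrite mulSn iterD exprS -mulrA; exact: H (coneh _) Ht IH.
have := bnd xi [:: 1%g] isT; rewrite big_seq1 => /le_trans; apply.
rewrite ler_wpM2r// lerXn2r ?nnegrE//; lra.
Qed.

Lemma linear_lower_bound (ell : G -> nat) (ball : nat -> seq G) (K : nat) :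
  (forall n g, (g \in ball n) = (ell g <= n)%N) -> (forall n, uniq (ball n)) ->
  (forall n, (size (ball n) <= K ^ n)%N) ->
  hoelder_continuous phi -> has_jacobian nu phi ->
  topologically_transitive (@skew_product A X G gamma) ->
  word_hyperbolic R G -> non_elementary G ->
  exists L, forall p, (2 <= p)%N -> exists2 j, (j <= L * p)%N &
    ((p%:R / 2)%:E < \int[nu]_xi ((ell (cocycle gamma j xi))%:R)%:E)%E.
Proof.
move=> mem_ball ball_uniq ball_size hphi jac tr hyp ne.
have [N [rho [rho0 rho1 decay]]] := lazy_decay hphi tr hyp ne.
have cphi : continuous phi.
  by have [C [r [C0 r0 r1 h]]] := hoelder_geometric hphi; exact: hoelder_is_continuous h.
(* Since [rho^c K <= 1/2], after [c p] rounds of [N] steps the squared mass of the ball of radius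
   [p] is at most [2^-p], hence at most [1/4] by [2 <= p]. *)
have [c _ Hc] : exists2 c, (0 <= c)%N & rho ^+ c <= (2 * (K%:R + 1))^-1.
  by apply: expr_small => //; rewrite invr_gt0 mulr_gt0// ltr_wpDl.
exists (c * N)%N => p p2; apply: contrapT => no.
pose m := (c * p * N)%N.
pose W : G -> R := fun g => (ell g)%:R.
have W0 g : 0 <= W g by [].
have : (\int[nu]_xi (iter m lazy (fun _ => W) xi 1%g)%:E <= (p%:R / 2)%:E)%E.
  apply: integral_iter_lazy_le => // j jm; rewrite leNgt; apply/negP => h; apply: no.
  by exists j => //; rewrite mulnAC.
apply/negP; rewrite -ltNge.
have small xi : iter m lazy (fun _ g => (g \in ball p)%:R) xi 1%g <= 1/2.
  have h0 : 0 <= iter m lazy (fun _ g => (g \in ball p)%:R) xi 1%g by exact: iter_lazy_ge0.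
  have h1 : iter m lazy (fun _ g => (g \in ball p)%:R) xi 1%g ^+ 2 <= 4^-1.
    apply: (le_trans (decay (c * p)%N (ball p) xi (ball_uniq p))).
    apply: (@le_trans _ _ ((rho ^+ c * K%:R) ^+ p)).
      rewrite exprMn -exprM; apply: ler_wpM2l; first exact/exprn_ge0/ltW.
      by rewrite -natrX ler_nat.
    have h2 : rho ^+ c * K%:R <= 2^-1.
      apply: (@le_trans _ _ ((2 * (K%:R + 1))^-1 * K%:R)); first by rewrite ler_wpM2r.
      by rewrite mulrC ler_pdivrMr ?mulr_gt0 ?ltr_wpDl// mulrA mulVf// mul1r lerDl.
    have h3 : 0 <= rho ^+ c * K%:R by rewrite mulr_ge0// exprn_ge0// ltW.
    apply: (@le_trans _ _ (2^-1 ^+ p)); first by rewrite lerXn2r ?nnegrE.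
    apply: (@le_trans _ _ (2^-1 ^+ 2)); last by rewrite exprVn -natrX.
    by rewrite ler_wiXn2l// invf_le1 ?ler1n.
  by nra.
(* Off the ball the length is at least [p + 1], not just [p]; this makes the final inequality
   strict. *)
have big xi : (p%:R + 1) / 2 <= iter m lazy (fun _ => W) xi 1%g.
  have : iter m lazy (fun _ _ => p%:R + 1) xi 1%g <=
     iter m lazy (fun eta g => (p%:R + 1) * (g \in ball p)%:R + (fun _ => W) eta g) xi 1%g.
    apply: iter_lazy_le => eta g; rewrite mem_ball; case: leqP => h.
      by rewrite mulr1 lerDl.
    by rewrite mulr0 add0r natr1 ler_nat.
  rewrite iter_lazy_lin iter_lazy_const//; have := small xi.
  have : (0 : R) <= p%:R by [].
  by nra.
apply: (@lt_le_trans _ _ ((p%:R + 1) / 2)%:E); first by rewrite lte_fin ltr_pM2r ?ltrDl.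
apply: (@le_trans _ _ (\int[nu]_xi (cst ((p%:R + 1) / 2)%:E xi))%E).
  by rewrite integral_cst//= probability_setT mule1.
apply: ge0_le_integral => //.
- by move=> xi _; rewrite lee_fin divr_ge0// addr_ge0.
- apply/measurable_EFinP; apply: continuous_measurable_sft.
  by apply: iter_lazy_continuous => //; exact: fibre_continuous_cst.
- by move=> xi _; rewrite lee_fin.
Qed.

End LinearSpeed.

(** * The subadditive ergodic theorem *)

Section Subadditive.
Context d (T : measurableType d) (R : realType) (P : probability T R) (theta : T -> T).
Hypothesis mtheta : measurable_fun setT theta.
Hypothesis inv : forall B, measurable B -> P (theta @^-1` B) = P B.
Hypothesis erg : forall B : set T, measurable B -> theta @^-1` B = B -> P B = 0%E \/ P B = 1%E.

Lemma measurable_iter n : measurable_fun setT (iter n theta).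
Proof.
elim: n => [|n IH]; first exact: measurable_id.
rewrite (_ : iter n.+1 theta = theta \o iter n theta)//; exact: measurableT_comp.
Qed.

Lemma iter_invariant n B : measurable B -> P (iter n theta @^-1` B) = P B.
Proof.
elim: n B => // n IH B mB.
have mB' : measurable (theta @^-1` B) by rewrite -[X in measurable X]setTI; exact: mtheta.
by rewrite -(inv mB) -(IH _ mB').
Qed.

Lemma integral_invariant n (f : T -> R) : measurable_fun setT f -> (forall x, 0 <= f x) ->
  (\int[P]_x (f (iter n theta x))%:E = \int[P]_x (f x)%:E)%E.
Proof.
move=> mf f0.
have := @ge0_integral_pushforward _ _ T T R _ (measurable_iter n) P setT (EFin \o f) measurableT.
move=> /(_ _ _)/esym H; rewrite H; last 2 first.
- exact/measurable_EFinP.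
- by move=> x _; rewrite lee_fin.
apply: eq_measure_integral; [exact: measurable_iter|move=> mi B mB _; exact: iter_invariant].
Qed.

Record subadditive_cocycle (f : nat -> T -> R) (C : R) : Prop := {
  sc_measurable : forall n, measurable_fun setT (f n);
  sc_ge0 : forall n x, 0 <= f n x;
  sc_zero : forall x, f 0%N x = 0;
  sc_bound : forall x, f 1%N x <= C;
  sc_sub : forall m n x, f (m + n)%N x <= f m x + f n (iter m theta x);
  sc_shift : forall n x, `|f n.+1 x - f n (theta x)| <= C }.

Section Lower.
Variables (f : nat -> T -> R) (C : R).
Hypothesis fC : subadditive_cocycle f C.

Lemma sc_C_ge0 : 0 <= C.
Proof. by have x := (point : T); exact: le_trans (sc_ge0 fC 1 x) (sc_bound fC x). Qed.

Lemma sc_le n x : f n x <= C * n%:R.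
Proof.
elim: n x => [|n IH] x; first by rewrite (sc_zero fC) mulr0.
rewrite -add1n; apply: le_trans (sc_sub fC 1 n x) _.
by rewrite natrD mulrDr mulr1 lerD ?(sc_bound fC)//; exact: IH.
Qed.

Definition slow (c : R) (N : nat) : set T :=
  [set y | exists m, [/\ (0 < m)%N, (m <= N)%N & f m y <= c * m%:R]].

(* Cut the orbit into pieces: from a slow point jump over a time at which [f] is small,
   otherwise advance by one. *)
Lemma greedy_cover (c : R) (N : nat) (x : T) n : 0 <= c ->
  f n x <= c * n%:R + C * \sum_(i < n) \1_(~` slow c N) (iter i theta x) + C * N%:R.
Proof.
move=> c0; have C0 := sc_C_ge0; set B := ~` _.
have badge0 m y : 0 <= \sum_(i < m) \1_B (iter i theta y) :> R by apply: sumr_ge0.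
elim/ltn_ind: n x => n IH x.
have [nN|Nn] := leqP n N.
  apply: le_trans (sc_le n x) _.
  have : C * n%:R <= C * N%:R by rewrite ler_wpM2l// ler_nat.
  have : 0 <= c * n%:R by rewrite mulr_ge0.
  have := mulr_ge0 C0 (badge0 n x); lra.
have split_sum m y : (m <= n)%N -> \sum_(i < n) \1_B (iter i theta y) =
    \sum_(i < m) \1_B (iter i theta y) +
    \sum_(i < n - m) \1_B (iter i theta (iter m theta y)) :> R.
  move=> mn; rewrite -!(big_mkord predT (fun i => \1_B (iter i theta _))).
  rewrite (big_cat_nat (n := m))//=; congr (_ + _).
  rewrite -{1}[m]add0n big_addn; apply: eq_bigr => i _.
  by rewrite iterD.
have [bx|] := pselect (B x); last first.
  move=> /contrapT[m [m0 mN fm]].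
  have mn : (m <= n)%N by rewrite (leq_trans mN)// ltnW.
  have lt : (n - m < n)%N by rewrite ltn_subrL m0 (leq_trans _ mn).
  have := sc_sub fC m (n - m) x; rewrite subnKC// => h.
  have h2 := IH _ lt (iter m theta x); rewrite (split_sum m x mn) mulrDr.
  have : c * n%:R = c * m%:R + c * (n - m)%:R by rewrite -mulrDr -natrD subnKC.
  have := mulr_ge0 C0 (badge0 m x); lra.
have n0 : (0 < n)%N by exact: leq_ltn_trans Nn.
have := sc_sub fC 1 (n - 1) x; rewrite subnKC// => h.
have lt : (n - 1 < n)%N by rewrite subn1 prednK.
have h2 := IH _ lt (iter 1 theta x); rewrite (split_sum 1%N x n0) mulrDr big_ord1/=.
rewrite indicE mem_set// mulr1.
have : c * (n - 1)%:R <= c * n%:R by rewrite ler_wpM2l// ler_nat leq_subr.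
have := sc_bound fC x; move: h h2; rewrite /=; lra.
Qed.

Lemma measurable_slow c N : measurable (slow c N).
Proof.
rewrite (_ : slow c N = \bigcup_(m in [set m | (0 < m <= N)%N]) (f m @^-1` [set y | y
  <= c * m%:R])).
  apply: bigcup_measurable => m _; rewrite -[X in measurable X]setTI.
  by apply: (sc_measurable fC) => //; rewrite -set_itvNyc; exact: measurable_itv.
apply/seteqP; split=> [y [m [m0 mN fm]]|y [m /andP[m0 mN] fm]]; exists m => //.
by rewrite /= m0.
Qed.

(* The event [liminf f_n / n < c]; the condition [sc_shift] makes it exactly invariant. *)
Definition often_slow (c : R) : set T := \bigcup_k \bigcap_N \bigcup_(n in [set n | (N <= n)%N])
  (f n @^-1` [set y | y <= (c - k.+1%:R^-1) * n%:R]).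

Lemma measurable_often_slow c : measurable (often_slow c).
Proof.
apply: bigcupT_measurable => k; apply: bigcapT_measurable => N; apply: bigcup_measurable => n _.
rewrite -[X in measurable X]setTI; apply: (sc_measurable fC) => //.
by rewrite -set_itvNyc; exact: measurable_itv.
Qed.

Lemma often_slow_intro c e x : 0 < e ->
  (forall N, exists2 n, (N <= n)%N & f n x <= (c - e) * n%:R) -> often_slow c x.
Proof.
move=> e0 H; pose k := Num.bound `|e^-1|.
have ke : k.+1%:R^-1 <= e.
  rewrite -[leRHS]invrK lef_pV2 ?posrE ?invr_gt0//.
  rewrite (le_trans (ler_norm _))// (le_trans (ltW (archi_boundP (normr_ge0 _))))//.
  by rewrite ler_nat.
exists k => // N _; have [n Nn h] := H N; exists n => //=.
by apply: le_trans h _; rewrite ler_wpM2r// lerD2l lerN2.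
Qed.

Lemma often_slow_invariant c : 0 <= c -> theta @^-1` often_slow c = often_slow c.
Proof.
move=> c0; have C0 := sc_C_ge0; apply/seteqP; split=> [x [k _ H]|x [k _ H]].
  set e := k.+1%:R^-1 in H; have e0 : 0 < e by rewrite invr_gt0.
  have e1 : e <= 1 by rewrite invf_le1 ?ler1n.
  (* Halving the margin leaves [e / 2 * n] to absorb the constant [C] and the shift of the index. *)
  apply: (@often_slow_intro _ (e / 2)); first by rewrite divr_gt0.
  move=> N; pose N0 := Num.bound `|(C + 1) * (e / 2)^-1|.
  have [n /= Nn h] := H (maxn N N0) I; exists n.+1.
    by rewrite (leq_trans _ (leqW Nn))// leq_maxl.
  have hn : C + 1 <= (e / 2) * n%:R.
    rewrite mulrC -ler_pdivrMr ?divr_gt0//.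
    rewrite (le_trans (ler_norm _))// (le_trans (ltW (archi_boundP (normr_ge0 _))))//.
    by rewrite ler_nat (leq_trans (leq_maxr N N0)).
  have := sc_shift fC n x; rewrite ler_norml => /andP[_ h2].
  have {}h : f n (theta x) <= (c - e) * n%:R := h.
  by rewrite -[n.+1%:R]natr1; nra.
set e := k.+1%:R^-1 in H; have e0 : 0 < e by rewrite invr_gt0.
apply: (@often_slow_intro _ (e / 2)); first by rewrite divr_gt0.
move=> N; pose N0 := Num.bound `|(C + c) * (e / 2)^-1|.
have [[|n] /= Nn h] := H (maxn N N0).+1 I; first by [].
rewrite ltnS in Nn; exists n; first by rewrite (leq_trans _ Nn)// leq_maxl.
have hn : C + c <= (e / 2) * n%:R.
  rewrite mulrC -ler_pdivrMr ?divr_gt0//.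
  rewrite (le_trans (ler_norm _))// (le_trans (ltW (archi_boundP (normr_ge0 _))))//.
  by rewrite ler_nat (leq_trans (leq_maxr N N0)).
have := sc_shift fC n x; rewrite ler_norml => /andP[h2 _].
have {}h : f n.+1 x <= (c - e) * n.+1%:R := h.
by move: h; rewrite -[n.+1%:R]natr1; nra.
Qed.

Lemma often_slow_subset c : often_slow c `<=` \bigcup_N slow c N.
Proof.
move=> x [k _ H]; have [n /= n0 h] := H 1%N I.
exists n => //; exists n; split=> //; apply: le_trans h _.
by rewrite ler_wpM2r// lerBlDr lerDl invr_ge0.
Qed.

(** By invariance of [P], each of the [n] times is bad with the same probability. *)
Lemma greedy_integral c N n : 0 <= c ->
  (\int[P]_x (f n x)%:E <=
    (c * n%:R + C * (n%:R * fine (P (~` slow c N))) + C * N%:R)%:E)%E.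
Proof.
move=> c0; have C0 := sc_C_ge0; set B := ~` slow c N.
have mB : measurable B by apply: measurableC; exact: measurable_slow.
have mBi i : measurable (iter i theta @^-1` B).
  by rewrite -[X in measurable X]setTI; exact: measurable_iter.
have mind i : measurable_fun setT (fun x => \1_B (iter i theta x) : R).
  by rewrite (_ : (fun x => _) = \1_(iter i theta @^-1` B)).
apply: (@le_trans _ _ (\int[P]_x ((c * n%:R + C * N%:R)%:E + C%:E * \sum_(i < n) (\1_B (iter
  i theta x))%:E))%E).
  apply: ge0_le_integral => //.
  - by move=> x _; rewrite lee_fin (sc_ge0 fC).
  - by apply/measurable_EFinP; exact: (sc_measurable fC).
  - apply: emeasurable_funD => //; apply: measurable_funeM; apply: emeasurable_sum => i.
    exact/measurable_EFinP.
  - move=> x _; rewrite sumEFin -EFinM -EFinD lee_fin.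
    by have := greedy_cover N x n c0; rewrite -/B; lra.
have pB : P B = (fine (P B))%:E by rewrite fineK// fin_num_measure.
have mS : measurable_fun setT (fun x => (\sum_(i < n) (\1_B (iter i theta x) : R)%:E)%E).
  by apply: emeasurable_sum => i; exact/measurable_EFinP.
have S0 x : (0 <= \sum_(i < n) (\1_B (iter i theta x) : R)%:E)%E.
  by apply: sume_ge0 => i _; rewrite lee_fin.
have E i : (\int[P]_x (\1_B (iter i theta x) : R)%:E = (fine (P B))%:E)%E.
  by rewrite -pB -(iter_invariant i mB) -[X in P X]setIT -integral_indic.
have ES : (\int[P]_x (\sum_(i < n) (\1_B (iter i theta x) : R)%:E)%E = (n%:R * fine (P B))%:E)%E.
  rewrite ge0_integral_sum//=; last first.
    by move=> i; exact/measurable_EFinP.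
  under eq_bigr do rewrite E.
  by rewrite sumEFin big_const_ord iter_addr_0 mulr_natl.
rewrite ge0_integralD//=; last first.
- exact: measurable_funeM.
- by move=> x _; rewrite mule_ge0.
- by move=> x _; rewrite lee_fin addr_ge0// mulr_ge0.
rewrite integral_cst//= probability_setT mule1 ge0_integralZl// ES -EFinM -EFinD lee_fin; lra.
Qed.

(** For [b] strictly between [c] and [a], the event [often_slow b] has probability [0] or [1]. If it
    were [1], almost every point would be slow within a bounded time up to small probability, and
    the greedy covering would push the mean of [f n] below [a n]. *)
Lemma sc_lower (a : R) : (forall n, ((a * n%:R)%:E <= \int[P]_x (f n x)%:E)%E) ->
  forall c, c < a -> {ae P, forall x, \forall n \near \oo, c * n%:R <= f n x}.
Proof.
move=> fa c ca; have C0 := sc_C_ge0.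
have [c0|c0] := leP 0 c; last first.
  apply: aeW => x; near=> n; apply: le_trans (sc_ge0 fC n x).
  by apply: mulr_le0_ge0 => //; exact: ltW.
pose b := (c + a) / 2; have b0 : 0 <= b by rewrite /b; lra.
have cb : c < b by rewrite /b; lra.
have ba : b < a by rewrite /b; lra.
have [B0|B1] := erg (measurable_often_slow b) (often_slow_invariant b0).
  exists (often_slow b); split=> //; first exact: measurable_often_slow.
  move=> x /= nQ; apply: (@often_slow_intro _ (b - c)); first by rewrite subr_gt0.
  apply: contrapT => /existsNP[N HN]; apply: nQ; exists N => // n /= Nn.
  by rewrite leNgt; apply/negP => h; apply: HN; exists n => //; rewrite opprB addrC subrK ltW.
(* Half of the gap [a - b] pays for the bad points; the other half pays for the boundary term [C N]
   once [n] is large. *)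
exfalso; pose e := (a - b) / (2 * (C + 1)).
have e0 : 0 < e by rewrite divr_gt0 ?subr_gt0// mulr_gt0// ltr_wpDl.
have mU : measurable (\bigcup_N slow b N) by apply: bigcupT_measurable => N;
  exact: measurable_slow.
have PU : P (\bigcup_N slow b N) = 1%E.
  apply/eqP; rewrite eq_le probability_le1//= -B1 le_measure ?inE//;
    first exact: measurable_often_slow.
  exact: often_slow_subset.
have nd : {homo slow b : n m / (n <= m)%N >-> (n <= m)%O}.
  move=> n m nm; apply/subsetPset => y [k [k0 kn fk]]; exists k; split=> //.
  exact: leq_trans nm.
have cvgP : (P \o slow b) x @[x --> \oo] --> 1%:E.
  by rewrite -PU; apply: nondecreasing_cvg_mu => // N; exact: measurable_slow.
have [N HN] : exists N, fine (P (~` slow b N)) <= e.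
  have cvgf : (fine \o (P \o slow b)) x @[x --> \oo] --> (1 : R) by apply: fine_cvg; exact: cvgP.
  have /cvgrPdist_le/(_ e e0) [N _ HN] := cvgf.
  exists N; have := HN N (leqnn N); rewrite /= probability_setC; last exact: measurable_slow.
  rewrite fineB//; last by rewrite fin_num_measure//; exact: measurable_slow.
  by rewrite ler_norml => /andP[].
pose n := (Num.bound `|C * N%:R * ((a - b) / 2)^-1|).
have := le_trans (fa n) (greedy_integral N n b0); rewrite lee_fin => h.
have h1 : C * (n%:R * fine (P (~` slow b N))) <= (a - b) / 2 * n%:R.
  apply: (@le_trans _ _ (C * (n%:R * e))); first by rewrite !ler_wpM2l.
  have eC : C * e = (a - b) / 2 - e.
    by rewrite /e; field; rewrite gt_eqF// ltr_wpDl.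
  rewrite mulrCA eC [leRHS]mulrC ler_wpM2l//.
  by rewrite lerBlDr lerDl ltW.
have h2 : C * N%:R < (a - b) / 2 * n%:R.
  rewrite [ltRHS]mulrC -ltr_pdivrMr ?divr_gt0 ?subr_gt0//.
  by apply: le_lt_trans (ler_norm _) _; exact: archi_boundP (normr_ge0 _).
lra.
Unshelve. all: by end_near. Qed.

End Lower.
End Subadditive.

(** * Upper half of the subadditive ergodic theorem *)

Section Upper.
Context d (T : measurableType d) (R : realType) (P : probability T R) (theta : T -> T).
Hypothesis mtheta : measurable_fun setT theta.
Hypothesis inv : forall B, measurable B -> P (theta @^-1` B) = P B.
Hypothesis erg : forall B : set T, measurable B -> theta @^-1` B = B -> P B = 0%E \/ P B = 1%E.
Variables (f : nat -> T -> R) (C : R).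
Hypothesis fC : subadditive_cocycle theta f C.

Lemma sum_iter_split (h : T -> R) m n x :
  \sum_(i < m + n) h (iter i theta x) =
  \sum_(i < m) h (iter i theta x) + \sum_(i < n) h (iter i theta (iter m theta x)).
Proof.
rewrite big_split_ord/=; congr (_ + _); apply: eq_bigr => i _.
by rewrite -iterD addnC.
Qed.

(** For each offset [j < k] the orbit is cut into blocks of length [k]; over all offsets each
    starting time occurs at most once. The error comes from the end, where [k] terms of at most
    [2 C k] remain. *)
Lemma block_sum k n x : (0 < k)%N ->
  \sum_(j < k) f (n - j) (iter j theta x) <=
  \sum_(i < n) f k (iter i theta x) + 2 * C * k%:R ^+ 2.
Proof.
move=> k0; have C0 := sc_C_ge0 fC; elim/ltn_ind: n x => n IH x.
have [kn|nk] := leqP (2 * k) n; last first.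
  apply: (@le_trans _ _ (\sum_(j < k) 2 * C * k%:R)).
    apply: ler_sum => j _; apply: le_trans (sc_le fC _ _) _.
    rewrite -mulrA mulrCA ler_wpM2l// -natrM ler_nat.
    by rewrite (leq_trans (leq_subr _ _))// ltnW.
  have -> : \sum_(j < k) 2 * C * k%:R = 2 * C * k%:R ^+ 2 :> R.
    by rewrite sumr_const card_ord -[LHS]mulr_natr expr2 !mulrA.
  rewrite lerDr.
  by apply: sumr_ge0 => i _; exact: (sc_ge0 fC).
have nE : (k + (n - k) = n)%N by rewrite subnKC// (leq_trans _ kn)// mul2n -addnn leq_addr.
rewrite -[in \sum_(i < n) _]nE sum_iter_split -addrA.
have lt : (n - k < n)%N by rewrite ltn_subrL k0 -nE ltn_addr.
apply: le_trans (lerD (lexx _) (IH _ lt (iter k theta x))).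
rewrite -big_split/=; apply: ler_sum => j _.
have -> : (n - j = k + (n - k - j))%N by have := ltn_ord j; lia.
have -> : iter j theta (iter k theta x) = iter k theta (iter j theta x) by rewrite -!iterD addnC.
exact: (sc_sub fC).
Qed.

(** Starting at time [j < k] instead of [0] costs at most [C k] per offset, hence a third
    [C k^2]. *)
Lemma block_average k n x : (0 < k)%N -> (k <= n)%N ->
  k%:R * f n x <= \sum_(i < n) f k (iter i theta x) + 3 * C * k%:R ^+ 2.
Proof.
move=> k0 kn; have C0 := sc_C_ge0 fC.
have -> : k%:R * f n x = \sum_(j < k) f n x by rewrite sumr_const card_ord mulr_natl.
apply: (@le_trans _ _ (\sum_(j < k) (C * k%:R + f (n - j) (iter j theta x)))).
  apply: ler_sum => j _; have jn : (j <= n)%N by rewrite (leq_trans _ kn)// ltnW.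
  rewrite -{1}(subnKC jn); apply: le_trans (sc_sub fC _ _ _) _; rewrite lerD2r.
  by apply: le_trans (sc_le fC _ _) _; rewrite ler_wpM2l// ler_nat ltnW.
rewrite big_split/= sumr_const card_ord -mulr_natr.
by have := block_sum n x k0; lra.
Qed.

(* This cocycle is additive: [sc_lower] for it is an upper bound for the Birkhoff sums of [f k]. *)
Lemma sc_deficit k : subadditive_cocycle theta
  (fun n x => \sum_(i < n) (C * k%:R - f k (iter i theta x))) (C * k%:R).
Proof.
have C0 := sc_C_ge0 fC.
have ge0 y : 0 <= C * k%:R - f k y by rewrite subr_ge0 (sc_le fC).
split.
- move=> n; apply: measurable_sum => i; apply: measurable_funB => //.
  by apply: measurableT_comp; [exact: (sc_measurable fC)|exact: measurable_iter].
- by move=> n x; apply: sumr_ge0.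
- by move=> x; rewrite big_ord0.
- by move=> x; rewrite big_ord1 lerBlDr lerDl (sc_ge0 fC).
- by move=> m n x; rewrite (sum_iter_split (fun y => C * k%:R - f k y)).
- move=> n x; rewrite -add1n (sum_iter_split (fun y => C * k%:R - f k y)) big_ord1/= addrK.
  by rewrite ger0_norm// lerBlDr lerDl (sc_ge0 fC).
Qed.

(** The lower bound for the deficits, taken at the midpoint of [b] and [c], bounds the Birkhoff sums
    of [f k]; the remaining [(c - b) / 2 * n] absorbs the error of [block_average]. *)
Lemma sc_upper k (b c : R) : (0 < k)%N -> b < c ->
  (\int[P]_x (f k x)%:E <= (b * k%:R)%:E)%E ->
  {ae P, forall x, \forall n \near \oo, f n x <= c * n%:R}.
Proof.
move=> k0 bc fb; have C0 := sc_C_ge0 fC.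
have k0' : (0 : R) < k%:R by rewrite ltr0n.
pose s n x := \sum_(i < n) (C * k%:R - f k (iter i theta x)).
have mfi i : measurable_fun setT (fun x => f k (iter i theta x)).
  by apply: measurableT_comp; [exact: (sc_measurable fC)|exact: measurable_iter].
have lower n : (((C - b) * k%:R * n%:R)%:E <= \int[P]_x (s n x)%:E)%E.
  have H : (\int[P]_x ((s n x)%:E + \sum_(i < n) (f k (iter i theta x))%:E) = (C * k%:R *
    n%:R)%:E)%E.
    transitivity (\int[P]_x (cst (C * k%:R * n%:R)%:E x))%E.
      apply: eq_integral => x _; rewrite sumEFin -EFinD -big_split/=; congr (_%:E).
      under eq_bigr do rewrite subrK.
      by rewrite sumr_const card_ord -[LHS]mulr_natr.
    by rewrite integral_cst//= probability_setT mule1.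
  have I : (\int[P]_x (\sum_(i < n) (f k (iter i theta x))%:E)%E <= (b * k%:R * n%:R)%:E)%E.
    rewrite ge0_integral_sum//=; last 2 first.
    - by move=> i; exact/measurable_EFinP.
    - by move=> i x _; rewrite lee_fin (sc_ge0 fC).
    apply: (@le_trans _ _ (\sum_(i < n) (b * k%:R)%:E)%E).
      apply: lee_sum => i _; rewrite integral_invariant//; first exact: (sc_measurable fC).
      exact: (sc_ge0 fC).
    by rewrite sumEFin sumr_const card_ord -[X in (X%:E <= _)%E]mulr_natr.
  rewrite ge0_integralD//= in H; last 4 first.
  - by move=> x _; rewrite lee_fin (sc_ge0 (sc_deficit k)).
  - by apply/measurable_EFinP; exact: (sc_measurable (sc_deficit k)).
  - by move=> x _; apply: sume_ge0 => i _; rewrite lee_fin (sc_ge0 fC).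
  - by apply: emeasurable_sum => i; exact/measurable_EFinP.
  have -> : ((C - b) * k%:R * n%:R)%:E = ((C * k%:R * n%:R)%:E - (b * k%:R * n%:R)%:E)%E.
    by rewrite -EFinB; congr (_%:E); ring.
  by rewrite -H leeBlDr// leeD2l.
have cb : (C - (b + c) / 2) * k%:R < (C - b) * k%:R by rewrite ltr_pM2r//; lra.
have := sc_lower mtheta inv erg (sc_deficit k) lower cb.
apply: filterS => x [N _ HN].
pose N1 := Num.bound `|3 * C * k%:R * ((c - b) / 2)^-1|.
exists (maxn (maxn N N1) k) => // n /=; rewrite !geq_max => /andP[/andP[Nn N1n] kn].
have := HN n Nn; have := block_average x k0 kn.
rewrite /= sumrB sumr_const card_ord -mulr_natr.
move: (\sum_(i < n) _) => S h1 h2.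
have h3 : 3 * C * k%:R <= n%:R * ((c - b) / 2).
  rewrite -ler_pdivrMr ?divr_gt0 ?subr_gt0//.
  apply: le_trans (ler_norm _) _; apply: le_trans (ltW (archi_boundP (normr_ge0 _))) _.
  by rewrite ler_nat.
rewrite -(ler_pM2l k0'); nra.
Qed.

End Upper.

Section Kingman.
Context d (T : measurableType d) (R : realType) (P : probability T R) (theta : T -> T).
Hypothesis mtheta : measurable_fun setT theta.
Hypothesis inv : forall B, measurable B -> P (theta @^-1` B) = P B.
Hypothesis erg : forall B : set T, measurable B -> theta @^-1` B = B -> P B = 0%E \/ P B = 1%E.
Variables (f : nat -> T -> R) (C : R).
Hypothesis fC : subadditive_cocycle theta f C.

Lemma sc_expectation : exists e : nat -> R,
  [/\ forall n, (\int[P]_x (f n x)%:E = (e n)%:E)%E, forall n, 0 <= e n, forall n, e n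
    <= C * n%:R &
      forall m n, e (m + n)%N <= e m + e n].
Proof.
have le n : (\int[P]_x (f n x)%:E <= (C * n%:R)%:E)%E.
  apply: (@le_trans _ _ (\int[P]_x (cst (C * n%:R)%:E x))%E).
    apply: ge0_le_integral => //.
    - by move=> x _; rewrite lee_fin (sc_ge0 fC).
    - by apply/measurable_EFinP; exact: (sc_measurable fC).
    - by move=> x _; rewrite lee_fin (sc_le fC).
  by rewrite integral_cst//= probability_setT mule1.
have ge n : (0 <= \int[P]_x (f n x)%:E)%E.
  by apply: integral_ge0 => x _; rewrite lee_fin (sc_ge0 fC).
pose e n := fine (\int[P]_x (f n x)%:E)%E.
have eE n : (\int[P]_x (f n x)%:E = (e n)%:E)%E.
  by rewrite fineK// ge0_fin_numE// (le_lt_trans (le n))// ltry.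
exists e; split=> // [n|n|m n].
- by rewrite -lee_fin -eE.
- by rewrite -lee_fin -eE.
rewrite -lee_fin EFinD -!eE.
have <- : (\int[P]_x (f n (iter m theta x))%:E = \int[P]_x (f n x)%:E)%E.
  by apply: integral_invariant => //; [exact: (sc_measurable fC)|exact: (sc_ge0 fC)].
have mfn : measurable_fun setT (fun x => (f n (iter m theta x))%:E).
  apply/measurable_EFinP; apply: measurableT_comp; first exact: (sc_measurable fC).
  exact: measurable_iter.
have mf k : measurable_fun setT (fun x => (f k x)%:E).
  by apply/measurable_EFinP; exact: (sc_measurable fC).
rewrite -ge0_integralD//=.
- apply: ge0_le_integral => //.
  + by move=> x _; rewrite lee_fin (sc_ge0 fC).
  + exact: emeasurable_funD.
  + by move=> x _; rewrite -EFinD lee_fin (sc_sub fC).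
- by move=> x _; rewrite lee_fin (sc_ge0 fC).
- by move=> x _; rewrite lee_fin (sc_ge0 fC).
Qed.

(** [a] is the infimum of the mean speeds. The clauses on integrals are kept so that its positivity
    can be tested on expectations. *)
Lemma kingman : exists a : R,
  [/\ forall n, ((a * n%:R)%:E <= \int[P]_x (f n x)%:E)%E,
      forall c, a < c -> exists2 k, (0 < k)%N & (\int[P]_x (f k x)%:E <= (c * k%:R)%:E)%E &
      {ae P, forall x, f n x / n%:R @[n --> \oo] --> a}].
Proof.
have [e [eE e0 _ _]] := sc_expectation.
pose S := [set e n / n%:R | n in [set n | (0 < n)%N]].
have S0 : has_lbound S by exists 0 => _ [n _ <-]; rewrite divr_ge0.
have Sne : S !=set0 by exists (e 1%N / 1%:R); exists 1%N.
pose a := inf S.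
have lower n : ((a * n%:R)%:E <= \int[P]_x (f n x)%:E)%E.
  rewrite eE lee_fin; case: n => [|n]; first by rewrite mulr0.
  rewrite -ler_pdivlMr ?ltr0n//; apply: ge_inf => //.
  by exists n.+1.
have upper c : a < c -> exists2 k, (0 < k)%N & (\int[P]_x (f k x)%:E <= (c * k%:R)%:E)%E.
  move=> ac; have [_ [k k0 <-]] : exists2 y, S y & y < c.
    by apply: inf_lt => //; split.
  rewrite ltr_pdivrMr ?ltr0n// => h; exists k => //.
  by rewrite eE lee_fin ltW.
exists a; split=> //.
have H1 m : {ae P, forall x, \forall n \near \oo, (a - m.+1%:R^-1) * n%:R <= f n x}.
  by apply: (sc_lower mtheta inv erg fC lower); rewrite ltrBlDr ltrDl invr_gt0.
have H2 m : {ae P, forall x, \forall n \near \oo, f n x <= (a + m.+1%:R^-1) * n%:R}.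
  have [|k k0 hk] := upper (a + m.+1%:R^-1 / 2); first by rewrite ltrDl divr_gt0.
  apply: (sc_upper mtheta inv erg fC k0 _ hk).
  by rewrite ltrD2l ltr_pdivrMr// ltr_pMr ?invr_gt0// ltr1n.
have H3 : {ae P, forall x, forall m, (\forall n \near \oo, (a - m.+1%:R^-1) * n%:R <= f n x) /\
    (\forall n \near \oo, f n x <= (a + m.+1%:R^-1) * n%:R)}.
  by apply/ae_foralln => m; have := H1 m; have := H2 m; apply: filterS2.
apply: filterS H3 => x Hx; apply/cvgrPdist_le => eps eps0.
pose m := Num.bound `|eps^-1|.
have me : m.+1%:R^-1 <= eps.
  rewrite -[leRHS]invrK lef_pV2 ?posrE ?invr_gt0//.
  rewrite (le_trans (ler_norm _))// (le_trans (ltW (archi_boundP (normr_ge0 _))))//.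
  by rewrite ler_nat.
have [L U] := Hx m; near=> n.
have n0 : (0 < n)%N by near: n; exists 1%N.
have h1 : (a - m.+1%:R^-1) * n%:R <= f n x by near: n.
have h2 : f n x <= (a + m.+1%:R^-1) * n%:R by near: n.
rewrite ler_distlC; apply/andP; split.
  by rewrite ler_pdivlMr ?ltr0n//; apply: le_trans h1; rewrite ler_wpM2r// lerD2l lerN2.
by rewrite ler_pdivrMr ?ltr0n//; apply: le_trans h2 _; rewrite ler_wpM2r// lerD2l.
Unshelve. all: by end_near. Qed.

End Kingman.

Theorem theorem4p4 (R : realType) (A : finType) (X : sft A)
    (phi : sft_space X -> R) (nu : probability (borel_sft X) R)
    (G : groupType) (E : seq G) (gamma : A -> G) :
  topologically_transitive (@sft_shift A X) ->
  hoelder_continuous phi ->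
  normalized phi ->
  shift_invariant nu ->
  ergodic nu ->
  has_jacobian nu phi ->
  symmetric_generating E ->
  word_hyperbolic R G ->
  non_elementary G ->
  topologically_transitive (@skew_product A X G gamma) ->
  exists2 a : R, 0 < a &
    {ae nu, forall xi : borel_sft X,
      word_dist R E (cocycle gamma n xi) 1%g / n%:R @[n --> \oo] --> a}.
Proof.
move=> _ hphi normphi inv erg jac symE hyp ne tr.
have [ell [ball [[ell1 ellV ellM] _ [mem_ball ball_uniq ball_size] ellE]]]
  := word_length_nat R symE.
pose theta : borel_sft X -> borel_sft X := @sft_shift A X.
have mtheta : measurable_fun setT theta.
  by apply: continuous_measurable_sft2; exact: shift_continuous.
pose f n (xi : borel_sft X) : R := (ell (cocycle gamma n xi))%:R.
pose C : R := (\max_(a : A) ell (gamma a))%:R.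
have cocycleS n (xi : sft_space X) :
    cocycle gamma n.+1 xi = (gamma (letter xi 0) * cocycle gamma n (sft_shift xi))%g.
  rewrite /cocycle big_ord_recl; congr (_ * _)%g.
  by apply: eq_bigr => i _; rewrite lift0 iterSr.
have cocycleD m n (xi : sft_space X) :
    cocycle gamma (m + n) xi = (cocycle gamma m xi * cocycle gamma n (iter m (@sft_shift A X)
      xi))%g.
  elim: m xi => [|m IH] xi; first by rewrite /cocycle big_ord0 mul1g.
  by rewrite addSn !cocycleS IH mulgA iterSr.
have gammaC a : (ell (gamma a))%:R <= C by rewrite ler_nat; exact: leq_bigmax.
have fC : subadditive_cocycle theta f C.
  split.
  - move=> n; apply: continuous_measurable_sft => xi; apply: cvg_near_cst.
      exact: (@nbhs_filter (sft_space X)).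
    have := near_agree n xi; apply: filterS => eta ag.
    rewrite /f /cocycle; congr (ell _)%:R; apply: eq_bigr => i _.
    by rewrite /gamma_sft !letter_iter_shift addn0 ag.
  - by [].
  - by move=> xi; rewrite /f /cocycle big_ord0 ell1.
  - by move=> xi; rewrite /f /cocycle big_ord1; exact: gammaC.
  - by move=> m n xi; rewrite /f cocycleD -natrD ler_nat.
  - move=> n xi; rewrite /f cocycleS ler_distl; apply/andP; split.
      rewrite lerBlDr (le_trans _ (lerD (lexx _) (gammaC (letter xi 0))))//.
      rewrite -natrD ler_nat addnC -{1}(mulKg (gamma (letter xi 0)) (cocycle gamma n _)).
      by rewrite (leq_trans (ellM _ _))// ellV.
    rewrite (le_trans _ (lerD (lexx _) (gammaC (letter xi 0))))//.
    by rewrite -natrD ler_nat addnC.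
have [a [lower upper lim]] := kingman mtheta inv erg fC.
exists a; last first.
  apply: filterS lim => xi; apply: cvg_trans; apply: near_eq_cvg.
  by near=> n; rewrite /word_dist mulg1 ellE ellV.
(* If [a <= 0], some mean [e k] is at most [c k], hence [e n <= c n + C k] for all [n]. At the time
   [j <= L p] of linear escape, the choices of [c] and [p] make both terms at most [p / 8], against
   [e j > p / 2]. *)
rewrite ltNge; apply/negP => a0.
have [L HL] := linear_lower_bound normphi mem_ball ball_uniq ball_size hphi jac tr hyp ne.
have [e [eE e0 eC esub]] := sc_expectation mtheta inv fC.
have C0 : 0 <= C by [].
pose c : R := (8 * L.+1%:R)^-1; have c0 : 0 < c by rewrite invr_gt0 mulr_gt0.
have [|k k0] := upper c; first exact: le_lt_trans c0.
rewrite eE lee_fin => ek.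
have elin n : e n <= c * n%:R + C * k%:R.
  elim/ltn_ind: n => n IH; have [nk|kn] := ltnP n k.
    apply: (le_trans (eC n)); apply: (@le_trans _ _ (C * k%:R)).
      by rewrite ler_wpM2l// ler_nat ltnW.
    by rewrite lerDr mulr_ge0// ltW.
  rewrite -(subnKC kn); apply: (le_trans (esub _ _)).
  have lt : (n - k < n)%N by rewrite ltn_subrL k0 (leq_trans k0).
  by have := IH _ lt; rewrite natrD mulrDr; lra.
pose p := (Num.bound (8 * (C * k%:R))).+2.
have Ckp : 8 * (C * k%:R) < p%:R.
  apply: (lt_le_trans (archi_boundP _)); first by rewrite !mulr_ge0.
  by rewrite ler_nat ltnW.
have [j jL] := HL p isT.
rewrite -/(f j) eE lte_fin => pj.
have cj : c * j%:R <= p%:R / 8.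
  rewrite /c mulrC ler_pdivrMr ?mulr_gt0//.
  rewrite mulrA divfK// -natrM ler_nat mulnC (leq_trans jL)// leq_mul2r leqnSn orbT //.
have p0 : 0 <= p%:R :> R by [].
move: (elin j) cj Ckp pj p0; move: (c * j%:R) (C * k%:R) (e j) (p%:R : R) => u v w z; lra.
Unshelve. all: by end_near. Qed.
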